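(* Let $X=HFG(P_M,Q_N)$ be a Hadamard fat grid in $\mathbb{P}^2$, with ideal $I(X)=\mathcal{I}(P_M,Q_N)\subset S=\mathbb{K}[x_0,x_1,x_2]$, and let $C_X,V_X\subset\mathbb{N}^2$ be the sets constructed from $M$ and $N$ in the context. Then a graded minimal free resolution of $I(X)$ is of the form $$0\longrightarrow\bigoplus_{(v_1,v_2)\in V_X}S(-v_1-v_2)\longrightarrow\bigoplus_{(c_1,c_2)\in C_X}S(-c_1-c_2)\longrightarrow I(X)\longrightarrow 0.$$
   Context: Let $\mathbb{K}$ be an algebraically closed field and $S=\mathbb{K}[x_0,x_1,x_2]$. For a point $P\in\mathbb{P}^2$, $I(P)\subset S$ is the ideal generated by all homogeneous polynomials vanishing at $P$; $\Delta_1$ is the union of the coordinate lines $x_i=0$ of $\mathbb{P}^2$. The Hadamard product of points is coordinatewise, $[p_0:p_1:p_2]\star[q_0:q_1:q_2]=[p_0q_0:p_1q_1:p_2q_2]$; for a line $\ell$ and a point $P\notin\Delta_1$, $\ell\star P$ is the line $\{L\star P: L\in\ell\}$. The Hadamard product of ideals $I,J\subset S$ is $I\star J=(I(\mathbf{y})+J(\mathbf{z})+\langle x_i-y_iz_i\mid i=0,1,2\rangle)\cap\mathbb{K}[x_0,x_1,x_2]$, where $I(\mathbf{y})$, $J(\mathbf{z})$ are the images of $I,J$ under $x_i\mapsto y_i$, $x_i\mapsto z_i$. Hadamard fat grid: let $\{P_1,\dots,P_r\}$ and $\{Q_1,\dots,Q_s\}$ be sets of distinct collinear points in $\mathbb{P}^2\setminus\Delta_1$,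 lying on lines $\ell_P$ and $\ell_Q$ respectively, with positive integer multiplicities $M=\{m_1,\dots,m_r\}$ and $N=\{n_1,\dots,n_s\}$, where $r\leq s$, $m_1\leq\cdots\leq m_r$ and $n_1\leq\cdots\leq n_s$. Put $I(P_M)=\bigcap_i I(P_i)^{m_i}$, $I(Q_N)=\bigcap_j I(Q_j)^{n_j}$. Assume $P_i\star Q_j\neq P_k\star Q_l$ for all $1\leq i<k\leq r$, $1\leq j<l\leq s$. The set of fat points defined by $I(P_M)\star I(Q_N)$ is the Hadamard fat grid $HFG(P_M,Q_N)$; its ideal is $\mathcal{I}(P_M,Q_N)=\bigcap_{i=1}^r\bigcap_{j=1}^s I(P_i\star Q_j)^{m_i+n_j-1}$. Its support $\{P_i\star Q_j\}$ is a complete intersection of type $(r,s)$, i.e. it consists of $rs$ distinct points, the intersections $(\ell_Q\star P_i)\cap(\ell_P\star Q_j)=\{P_i\star Q_j\}$ of the $r$ distinct lines $\ell_Q\star P_i$ with the $s$ distinct lines $\ell_P\star Q_j$. The sets $C_X$ and $V_X$: write $(n)_+=\max\{n,0\}$. For $i=1,\dots,r$ and $0\leq h\leq m_i+n_s-2$ put $a_{i,h}=\sum_{e=1}^s(m_i+n_e-1-h)_+$. Let $\mathcal{A}_X=(\alpha_1,\dots,\alpha_m)$ be the tuple, of length $m=\sum_{i=1}^r m_i+rn_s-r$, obtained by arranging all the $a_{i,h}$ (with repetitions) in descending order. Define $$C_X=\{(m,0),(0,\alpha_1)\}\cup\{(i-1,\alpha_i)\mid 2\leq i\leq m,\ \alpha_i-\alpha_{i-1}<0\},$$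 $$V_X=\{(m,\alpha_m)\}\cup\{(i-1,\alpha_{i-1})\mid 2\leq i\leq m,\ \alpha_i-\alpha_{i-1}<0\}.$$ *)

(* Defs.v *)
From HB Require Import structures.
From mathcomp Require Import all_boot all_order all_algebra.
From mathcomp Require Import finmap.
From mathcomp Require Export mpoly.

Set Implicit Arguments.
Unset Strict Implicit.
Unset Printing Implicit Defensive.

Import GRing.Theory.
Local Open Scope ring_scope.

(* Points of P^2 are given by homogeneous coordinates p : 'I_3 -> K, not all
   zero, and compared with peq; a set of points is a predicate on homogeneous
   coordinates. *)
Section ProjectivePlane.
Variable K : fieldType.
Implicit Types (p q x : 'I_3 -> K).

Definition nonzero p : Prop := exists i, p i != 0.

Definition peq p q : Prop := exists2 c, c != 0 & forall i, q i = c * p i.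

(* p lies outside the three coordinate lines. *)
Definition off_axes p : Prop := forall i, p i != 0.

Definition hprod p q : 'I_3 -> K := fun i => p i * q i.

(* The line a_0 x_0 + a_1 x_1 + a_2 x_2 = 0, for a nonzero. *)
Definition line (a : 'I_3 -> K) x : Prop :=
  nonzero x /\ \sum_i a i * x i = 0.

(* { L * p | L in l } *)
Definition line_hprod (l : ('I_3 -> K) -> Prop) p x : Prop :=
  exists2 L, l L & peq (hprod L p) x.

Definition same_points (A B : ('I_3 -> K) -> Prop) : Prop :=
  forall x, A x <-> B x.

Definition grid_complete_intersection (r s : nat)
    (lP lQ : ('I_3 -> K) -> Prop) (P : 'I_r -> 'I_3 -> K)
    (Q : 'I_s -> 'I_3 -> K) : Prop :=
  [/\ forall i k j l,
        peq (hprod (P i) (Q j)) (hprod (P k) (Q l)) -> i = k /\ j = l,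
      forall i k,
        same_points (line_hprod lQ (P i)) (line_hprod lQ (P k)) -> i = k,
      forall j l,
        same_points (line_hprod lP (Q j)) (line_hprod lP (Q l)) -> j = l
    & forall i j x,
        line_hprod lQ (P i) x /\ line_hprod lP (Q j) x <->
        peq (hprod (P i) (Q j)) x].

End ProjectivePlane.

Section Ideals.
Variable K : fieldType.
Local Notation S := {mpoly K[3]}.

Definition ideal_gen (A : S -> Prop) (f : S) : Prop :=
  exists n (c g : 'I_n -> S),
    (forall i, A (g i)) /\ f = \sum_(i < n) c i * g i.

Definition ideal_pow (I : S -> Prop) (k : nat) : S -> Prop :=
  ideal_gen (fun f => exists g : 'I_k -> S,
    (forall i, I (g i)) /\ f = \prod_(i < k) g i).

Definition point_ideal (p : 'I_3 -> K) : S -> Prop :=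
  ideal_gen (fun f => (exists d : nat, f \is d.-homog) /\ f.@[p] = 0).

Definition irrelevant_ideal : S -> Prop :=
  ideal_gen (fun f => exists i : 'I_3, f = 'X_i).

Definition HFG_ideal (r s : nat) (P : 'I_r -> 'I_3 -> K)
    (Q : 'I_s -> 'I_3 -> K) (M : r.-tuple nat) (N : s.-tuple nat)
    (f : S) : Prop :=
  forall i j, ideal_pow (point_ideal (hprod (P i) (Q j)))
                        (tnth M i + tnth N j - 1)%N f.

End Ideals.

Section GradedResolution.
Variable K : fieldType.
Local Notation S := {mpoly K[3]}.

(* Together with deg : J -> nat this is the graded free module
   \bigoplus_(j in J) S(- deg j). *)
Definition free_module (J : finType) := {ffun J -> S^o}.

(* f lies in the component S(-a)_d = S_(d - a), which is 0 when d < a. *)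
Definition in_shift (a d : nat) (f : S) : Prop :=
  if (a <= d)%N then f \is (d - a).-homog : Prop else f = 0.

Definition in_degree (J : finType) (deg : J -> nat) (d : nat)
    (u : free_module J) : Prop :=
  forall j, in_shift (deg j) d (u j).

(* 0 -> \bigoplus_j S(- deg1 j) -phi-> \bigoplus_j S(- deg0 j) -eps-> I -> 0 is
   exact, with phi and eps homogeneous of degree 0, and the image of phi is
   contained in (x_0, x_1, x_2) \bigoplus_j S(- deg0 j). *)
Definition graded_minimal_free_resolution (J1 J0 : finType)
    (deg1 : J1 -> nat) (deg0 : J0 -> nat) (I : S -> Prop)
    (phi : {linear free_module J1 -> free_module J0})
    (eps : {linear free_module J0 -> S^o}) : Prop :=
  [/\ (forall d u, in_degree deg1 d u -> in_degree deg0 d (phi u)) /\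
      (forall d u, in_degree deg0 d u -> (eps u : S) \is d.-homog),
      injective phi,
      forall u, eps u = 0 <-> exists w, u = phi w,
      forall f, I f <-> exists u, f = eps u
    & forall u j, irrelevant_ideal (phi u j)].

End GradedResolution.

Section NumericalData.
Local Open Scope nat_scope.
Variables M N : seq nat.

(* a_(i,h), with mi = m_i. Since mi + n_e >= 1, the truncated subtraction
   computes the positive part (mi + n_e - 1 - h)_+. *)
Definition aX (mi h : nat) : nat := \sum_(ne <- N) (mi + ne - 1 - h).

(* All a_(i,h) for 0 <= h <= m_i + n_s - 2, in descending order. *)
Definition AX : seq nat :=
  sort geq [seq aX mi h | mi <- M, h <- iota 0 (mi + last 0 N - 1)].

Definition mX : nat := sumn M + size M * last 0 N - size M.

(* alpha_i, indexed from 1. *)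
Definition alphaX (i : nat) : nat := nth 0 AX i.-1.

(* The indices 2 <= i <= m such that alpha_i - alpha_(i-1) < 0. *)
Definition dropsX : seq nat :=
  [seq i <- iota 2 (mX - 1) | alphaX i < alphaX i.-1].

Definition CX : {fset nat * nat} :=
  [fset c in [:: (mX, 0); (0, alphaX 1)]
             ++ [seq (i.-1, alphaX i) | i <- dropsX]]%fset.

Definition VX : {fset nat * nat} :=
  [fset v in (mX, alphaX mX) :: [seq (i.-1, alphaX i.-1) | i <- dropsX]]%fset.

Lemma size_AX : all (leq 1) M -> size AX = mX.
Proof.
rewrite /AX /mX size_sort size_allpairs_dep.
under eq_map => mi do rewrite size_iota.
elim: M => [|a l IH] //= /andP[a_gt0 l_gt0]; rewrite IH //.
have le_size : size l <= sumn l.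
  by elim: l l_gt0 {IH} => [|b l IH] //= /andP[b_gt0 /IH]; rewrite -add1n; apply: leq_add.
rewrite addnBA ?(leq_trans le_size) ?leq_addr // mulSn.
by rewrite addnBAC ?(leq_trans a_gt0) ?leq_addr // -subnDA add1n addnACA.
Qed.

End NumericalData.

Definition total_degree (A : {fset nat * nat}) (c : A) : nat :=
  ((val c).1 + (val c).2)%N.

(* Main.v *)
Require Import Defs.
From HB Require Import structures.
From mathcomp Require Import all_boot all_order all_algebra.
From mathcomp Require Import finmap mpoly.
From mathcomp Require Import zify ring.

Set Implicit Arguments.
Unset Strict Implicit.
Unset Printing Implicit Defensive.

Import GRing.Theory.
Local Open Scope ring_scope.

(* Let R_i = l_Q * P_i, C_j = l_P * Q_j, and list the pairs (i, T) with
   1 <= T <= m_i + n_s - 1 by decreasing T; the pair (i, T) stands for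
   (i, h) with T = m_i + n_s - 1 - h. At each pair peel off one copy of the line
   R_i. Modulo R_i, an element of I(X) lies in the intersection of the ideals
   (C_j^(T - (n_s - n_j))), hence in the ideal of their product; subtracting
   and cancelling R_i leaves an element of the ideal of the smaller fat grid.
   So I(X) is generated by the products of the first k lines R_i with
   prod_j C_j^(T_(k+1) - (n_s - n_j)), and those k with T_(k+1) < T_k
   (together with k = 0) suffice. Two consecutive generators are related by
   U g = W g' with U a product of the R_i and W a product of the C_j; since the
   R_i are coprime to the C_j, these relations generate all syzygies: a bidiagonal
   Hilbert-Burch matrix. All local facts are checked after the linear change of
   coordinates sending R_i, C_j to x_0, x_1, where the ideals are monomial. *)

(** * Linear changes of coordinates and powers of point ideals *)

Section IdealGen.
Variable K : fieldType.
Local Notation S := {mpoly K[3]}.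
Implicit Types (A I : S -> Prop) (f g : S).

Lemma ideal_gen_min A (J : S -> Prop) :
    J 0 -> (forall f g, J f -> J g -> J (f + g)) ->
    (forall c g, A g -> J (c * g)) ->
  forall f, ideal_gen A f -> J f.
Proof. by move=> J0 JD JM f [n [c [g [gA ->]]]]; elim/big_ind: _ => // i _; exact: JM. Qed.

Lemma ideal_gen0 A : ideal_gen A 0.
Proof. by exists 0%N, (fun=> 0), (fun=> 0); split=> [[]|] //; rewrite big_ord0. Qed.

Lemma ideal_genD A f g : ideal_gen A f -> ideal_gen A g -> ideal_gen A (f + g).
Proof.
move=> [n [c [u [uA ->]]]] [m [d [v [vA ->]]]].
pose glue T (x : 'I_n -> T) (y : 'I_m -> T) i :=
  match split i with inl j => x j | inr j => y j end.
exists (n + m)%N, (glue _ c d), (glue _ u v); split.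
  by move=> i; rewrite /glue; case: (split i).
rewrite big_split_ord /glue; congr (_ + _); apply: eq_bigr => i _.
  by rewrite -[lshift _ _]/(unsplit (inl i)) unsplitK.
by rewrite -[rshift _ _]/(unsplit (inr i)) unsplitK.
Qed.

Lemma ideal_gen_mem A c g : A g -> ideal_gen A (c * g).
Proof.
by move=> Ag; exists 1%N, (fun=> c), (fun=> g); split=> //; rewrite big_ord1.
Qed.

Lemma ideal_genMl A c f : ideal_gen A f -> ideal_gen A (c * f).
Proof.
move: f; apply: ideal_gen_min => [|f g fA gA|d g gA].
- by rewrite mulr0; exact: ideal_gen0.
- by rewrite mulrDr; exact: ideal_genD.
- by rewrite mulrA; exact: ideal_gen_mem.
Qed.

Lemma ideal_pow0 I f : ideal_pow I 0 f.
Proof.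
rewrite -[f]mulr1; apply: ideal_gen_mem.
by exists (fun=> 0); split=> [[]|] //; rewrite big_ord0.
Qed.

Lemma ideal_powM I a b f g :
  ideal_pow I a f -> ideal_pow I b g -> ideal_pow I (a + b) (f * g).
Proof.
move=> fI gI; move: f fI; apply: ideal_gen_min.
- by rewrite mul0r; exact: ideal_gen0.
- by move=> f f' fI fI'; rewrite mulrDl; exact: ideal_genD.
move=> c _ [u [uI ->]]; rewrite -mulrA; apply: ideal_genMl.
move: g gI; apply: ideal_gen_min.
- by rewrite mulr0; exact: ideal_gen0.
- by move=> f f' fI fI'; rewrite mulrDr; exact: ideal_genD.
move=> d _ [v [vI ->]]; rewrite mulrCA; apply: ideal_gen_mem.
exists (fun i => match split i with inl j => u j | inr j => v j end); split.
  by move=> i; case: (split i).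
rewrite big_split_ord; congr (_ * _); apply: eq_bigr => i _.
  by rewrite -[lshift _ _]/(unsplit (inl i)) unsplitK.
by rewrite -[rshift _ _]/(unsplit (inr i)) unsplitK.
Qed.

Lemma ideal_powW I a b f : (a <= b)%N -> ideal_pow I b f -> ideal_pow I a f.
Proof.
move=> le_ab; rewrite -(subnKC le_ab); apply: ideal_gen_min.
- exact: ideal_gen0.
- by move=> g h; exact: ideal_genD.
move=> c _ [u [uI ->]]; rewrite big_split_ord mulrCA mulrC.
by apply: ideal_gen_mem; exists (fun i => u (lshift _ i)).
Qed.

Lemma ideal_pow_exp I k f : I f -> ideal_pow I k (f ^+ k).
Proof.
move=> If; rewrite -[f ^+ k]mul1r; apply: ideal_gen_mem.
by exists (fun=> f); split=> //; rewrite prodr_const card_ord.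
Qed.

End IdealGen.

(** The last premise ranges only over the support of [f], so that a constraint on its exponents,
    such as homogeneity or a lower bound on the order, is available for each term. *)
Lemma mpoly_msupp_ind n (R : nzRingType) (J : {mpoly R[n]} -> Prop) f :
    J 0 -> (forall g h, J g -> J h -> J (g + h)) ->
    (forall m, f@_m != 0 -> J (f@_m *: 'X_[m])) ->
  J f.
Proof.
move=> J0 JD JX; rewrite [f]mpolyE big_seq; elim/big_ind: _ => // m.
by rewrite mcoeff_msupp; exact: JX.
Qed.

Lemma mcoeff_mulXU n (R : comNzRingType) (i : 'I_n) (f : {mpoly R[n]}) m :
  ('X_i * f)@_(m + U_(i)) = f@_m.
Proof. by rewrite mulrC addmC mcoeffMX. Qed.

Lemma dvdX_mnm n (R : comNzRingType) (i : 'I_n) k (m : 'X_{1..n}) :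
  (k <= m i)%N -> exists m', 'X_[m] = 'X_i ^+ k * 'X_[m'] :> {mpoly R[n]}.
Proof.
move=> le_km; exists (m - U_(i) *+ k)%MM; rewrite mpolyXn -mpolyXD; congr 'X_[_].
apply/mnmP => j; rewrite mnmDE mnmBE mulmnE mnm1E.
by case: eqVneq => [<-|_]; rewrite ?mul1n ?mul0n ?subn0 // subnKC.
Qed.

(** * Linear forms and linear substitutions *)

Section LinearForms.
Variable K : fieldType.
Local Notation S := {mpoly K[3]}.
Implicit Types (a b d p : 'I_3 -> K) (f g : S).

Definition linform a : S := \sum_i a i *: 'X_i.

Definition dot a p : K := \sum_i a i * p i.

Definition indep a b : Prop :=
  forall x y, (forall i, x * a i + y * b i = 0) -> x = 0 /\ y = 0.

Lemma linform_eval a p : (linform a).@[p] = dot a p.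
Proof.
by rewrite /linform raddf_sum; apply: eq_bigr => i _; rewrite /= mevalZ mevalXU.
Qed.

Lemma linform_homog a : linform a \is 1.-homog.
Proof.
by apply: rpred_sum => i _; apply: rpredZ; rewrite dhomogX /= mdeg1.
Qed.

Lemma linform_point_ideal a p : dot a p = 0 -> point_ideal p (linform a).
Proof.
move=> ap; rewrite -[linform a]mul1r; apply: ideal_gen_mem; split.
  by exists 1%N; exact: linform_homog.
by rewrite linform_eval.
Qed.

Definition lin_subst (A : 'M[K]_3) f : S := f \mPo [tuple linform (A i) | i < 3].

HB.instance Definition _ A := GRing.LRMorphism.copy (lin_subst A)
  (comp_mpoly [tuple linform (A i) | i < 3]).

Lemma lin_substX A i : lin_subst A 'X_i = linform (A i).
Proof. by rewrite /lin_subst comp_mpolyXU -tnth_nth tnth_mktuple. Qed.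

Lemma lin_subst_linform A a :
  lin_subst A (linform a) = \sum_i a i *: linform (A i).
Proof.
by rewrite raddf_sum; apply: eq_bigr => i _; rewrite /= linearZ /= lin_substX.
Qed.

Lemma lin_substK A B : A *m B = 1%:M -> cancel (lin_subst B) (lin_subst A).
Proof.
(* Composing substitutions reverses the matrix product: x_i goes to the form with coefficients row i
   of [B *m A], so the inverse on the other side is the one needed. *)
move=> /mulmx1C BA1 f; apply: (@mpoly_msupp_ind _ _ (fun f => lin_subst A (lin_subst B f) = f)).
- by rewrite !raddf0.
- by move=> g h gE hE; rewrite !raddfD /= gE hE.
move=> m _; rewrite !linearZ /=; congr (_ *: _).
rewrite mpolyXE_id !rmorph_prod; apply: eq_bigr => i _; rewrite !rmorphXn /=.
congr (_ ^+ _); rewrite lin_substX lin_subst_linform.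
rewrite -[RHS]scale1r.
transitivity (\sum_k (B *m A) i k *: ('X_k : S)).
  under eq_bigr do rewrite scaler_sumr.
  rewrite exchange_big; apply: eq_bigr => k _ /=.
  by rewrite mxE scaler_suml; apply: eq_bigr => j _; rewrite scalerA.
rewrite BA1 (bigD1 i) //= big1 ?addr0 ?mxE ?eqxx // => k /negPf ki.
by rewrite mxE eq_sym ki scale0r.
Qed.

Lemma lin_subst_homog A n f : f \is n.-homog -> lin_subst A f \is n.-homog.
Proof.
move=> /dhomogP f_hom; apply: (@mpoly_msupp_ind _ _ (fun f => lin_subst A f \is n.-homog)).
- by rewrite raddf0; exact: rpred0.
- by move=> g h gE hE; rewrite raddfD /=; exact: rpredD.
move=> m; rewrite -mcoeff_msupp => /f_hom <-; rewrite linearZ /=; apply: rpredZ.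
rewrite mpolyXE_id rmorph_prod /= mdegE.
elim/big_ind2: _ => [|u i v j|i _]; first exact: dhomog1.
  exact: dhomogM.
rewrite rmorphXn /= lin_substX.
by have := dhomogMn (m i) (linform_homog (A i)); rewrite mul1n.
Qed.

Lemma lin_subst_eval A f p : (lin_subst A f).@[p] = f.@[fun i => dot (A i) p].
Proof.
rewrite comp_mpoly_meval; apply: meval_eq => i.
by rewrite tnth_mktuple linform_eval.
Qed.

Local Notation i0 := (@Ordinal 3 0 isT).
Local Notation i1 := (@Ordinal 3 1 isT).
Local Notation i2 := (@Ordinal 3 2 isT).

Lemma ord3P (i : 'I_3) : [\/ i = i0, i = i1 | i = i2].
Proof.
by case: i => [[|[|[|//]]] lt_i]; [constructor 1|constructor 2|constructor 3];
  apply: val_inj.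
Qed.

Lemma big_ord3 (T : Type) (idx : T) (op : Monoid.law idx) (G : 'I_3 -> T) :
  \big[op/idx]_i G i = op (G i0) (op (G i1) (G i2)).
Proof.
rewrite !big_ord_recl big_ord0 Monoid.mulm1.
by congr (op (G _) (op (G _) (G _))); apply: val_inj.
Qed.

(* Linear coordinates (a, b, d) in which the point p becomes [0 : 0 : 1]. *)
Definition frame a b d p : Prop :=
  [/\ indep a b, dot a p = 0, dot b p = 0 & dot d p != 0].

Definition frame_mx a b d : 'M[K]_3 :=
  \matrix_(i < 3) \row_j (if i == i0 then a j else if i == i1 then b j else d j).

(** A relation among the rows, paired with [p], loses its [a] and [b] terms, so the coefficient of
    [d] is zero; independence of [a] and [b] removes the other two. *)
Lemma frame_unit a b d p : frame a b d p -> frame_mx a b d \in unitmx.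
Proof.
move=> [ab ap bp dp]; rewrite -row_free_unit; apply/inj_row_free => v vA0.
have E j : v 0 i0 * a j + v 0 i1 * b j + v 0 i2 * d j = 0.
  have := congr1 (fun w : 'rV_3 => w 0 j) vA0; rewrite !mxE => <-.
  by rewrite big_ord3 !mxE /= addrA.
have v2 : v 0 i2 = 0.
  apply/eqP; move: (mulf_eq0 (v 0 i2) (dot d p)); rewrite (negPf dp) orbF => <-.
  apply/eqP; transitivity (\sum_j (v 0 i0 * a j + v 0 i1 * b j + v 0 i2 * d j) * p j).
    under eq_bigr do rewrite 2!mulrDl -!mulrA.
    rewrite !big_split /= -!mulr_sumr -/(dot a p) -/(dot b p) -/(dot d p).
    by rewrite ap bp !mulr0 !add0r.
  by rewrite big1 // => j _; rewrite E mul0r.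
have [v0 v1] : v 0 i0 = 0 /\ v 0 i1 = 0.
  by apply: ab => j; rewrite -[RHS](E j) v2 mul0r addr0.
by apply/rowP => j; rewrite mxE; case: (ord3P j) => ->.
Qed.

(** * Point ideals in adapted coordinates *)

Section Frame.
Variables (a b d p : 'I_3 -> K) (F : frame a b d p).
Let A := frame_mx a b d.
(** [to] rewrites a polynomial in the coordinates of the frame, turning the forms [a], [b], [d] into
    variables; [from] expands it back. *)
Let to := lin_subst (invmx A).
Let from := lin_subst A.

Lemma frame_toK : cancel to from.
Proof. by apply: lin_substK; apply: mulmxV; exact: frame_unit F. Qed.

Lemma frame_fromK : cancel from to.
Proof. by apply: lin_substK; apply: mulVmx; exact: frame_unit F. Qed.

Lemma frame_from0 : from 'X_i0 = linform a.
Proof. by rewrite /from lin_substX; apply: eq_bigr => i _; rewrite !mxE. Qed.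

Lemma frame_from1 : from 'X_i1 = linform b.
Proof. by rewrite /from lin_substX; apply: eq_bigr => i _; rewrite !mxE. Qed.

Lemma frame_from2 : from 'X_i2 = linform d.
Proof. by rewrite /from lin_substX; apply: eq_bigr => i _; rewrite !mxE. Qed.

Lemma frame_to0 : to (linform a) = 'X_i0.
Proof. by rewrite -frame_from0 frame_fromK. Qed.

Lemma frame_to1 : to (linform b) = 'X_i1.
Proof. by rewrite -frame_from1 frame_fromK. Qed.

Lemma frame_to2 : to (linform d) = 'X_i2.
Proof. by rewrite -frame_from2 frame_fromK. Qed.

(** Membership in the monomial ideal (x_0, x_1)^k. *)
Let order_ge k g := forall m, g@_m != 0 -> (k <= m i0 + m i1)%N.

Lemma order_ge0 k : order_ge k 0.
Proof. by move=> m; rewrite mcoeff0 eqxx. Qed.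

Lemma order_geD k f g : order_ge k f -> order_ge k g -> order_ge k (f + g).
Proof.
move=> fk gk m; rewrite mcoeffD; have [->|/fk//] := eqVneq f@_m 0.
by rewrite add0r; exact: gk.
Qed.

Lemma order_geM k l f g :
  order_ge k f -> order_ge l g -> order_ge (k + l) (f * g).
Proof.
move=> fk gl m; rewrite -mcoeff_msupp => /msuppM_le /allpairsP[[u v]] /=.
rewrite !mcoeff_msupp => -[/fk le_k /gl le_l ->].
by rewrite !mnmDE addnACA leq_add.
Qed.

(** For a homogeneous generator of degree n, the only monomial of order zero is x_2^n. In the frame
    only [d] is nonzero at [p], so the value at [p] is the coefficient of x_2^n times a nonzero
    scalar, and that coefficient vanishes. *)
Lemma point_ideal_order f : point_ideal p f -> order_ge 1 (to f).
Proof.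
move: f; apply: ideal_gen_min.
- by rewrite /to raddf0; exact: order_ge0.
- by move=> f g; rewrite /to raddfD; exact: order_geD.
move=> c f [[n f_hom] fp]; rewrite /to rmorphM /=.
apply: (@order_geM 0 1); first by [].
have tf_hom : to f \is n.-homog by exact: lin_subst_homog.
move=> m m_supp; rewrite lt0n addn_eq0; apply: contra m_supp => /andP[/eqP m0 /eqP m1].
have tf_eval : (to f).@[fun i => dot (A i) p] = 0 by rewrite -lin_subst_eval -/from frame_toK.
have AE i : dot (A i) p = if i == i2 then dot d p else 0.
  have [_ ap bp _] := F.
  by case: (ord3P i) => -> /=; [rewrite -ap|rewrite -bp|]; apply: eq_bigr => j _; rewrite !mxE.
apply/eqP; case: (eqVneq (to f)@_m 0) => [//|m_supp]; move: tf_eval.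
have md : mdeg m = n by apply: (dhomog_mf tf_hom); rewrite mcoeff_msupp.
rewrite mevalE (bigD1_seq m) ?mcoeff_msupp ?msupp_uniq //= [X in _ + X]big1_seq ?addr0.
    move=> /eqP; rewrite mulf_eq0 => /orP[/eqP //|].
  have [_ _ _ dp] := F.
  rewrite big_ord3 m0 m1 !AE.
  by rewrite /= !expr0 !mul1r expf_eq0 (negPf dp) andbF.
(* Another monomial free of x_0 and x_1 would have the same degree, hence equal [m]; so [m']
   contains one of the two variables, which is zero at the point. *)
move=> m' /andP[ne m'_supp]; apply/eqP; rewrite mulf_eq0; apply/orP; right.
have md' : mdeg m' = n by apply: (dhomog_mf tf_hom).
have : (m' i0 != 0%N) || (m' i1 != 0%N).
  rewrite -negb_and; apply: contra ne => /andP[/eqP m'0 /eqP m'1]; apply/eqP/mnmP => j.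
  have : mdeg m = mdeg m' by rewrite md md'.
  rewrite !mdegE !big_ord3 /= m0 m1 m'0 m'1 !add0n => e2.
  by case: (ord3P j) => ->; rewrite ?m0 ?m1 ?m'0 ?m'1.
case/orP=> /negPf ne0.
  by rewrite (bigD1 i0) //= AE /= expr0n ne0 mul0r.
by rewrite (bigD1 i1) //= AE /= expr0n ne0 mul0r.
Qed.

(** Conversely, a monomial of order at least k is divisible by k factors x_0 or x_1, which come from
    the linear forms [a] and [b] vanishing at [p]. *)
Lemma ideal_pow_pointE k f :
  ideal_pow (point_ideal p) k f <-> order_ge k (to f).
Proof.
split=> [|fk].
  move: f; apply: ideal_gen_min.
  - by rewrite /to raddf0; exact: order_ge0.
  - by move=> f g; rewrite /to raddfD; exact: order_geD.
  move=> c _ [u [uI ->]]; rewrite /to rmorphM rmorph_prod /=.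
  apply: (@order_geM 0 k) => //; elim: k u uI => [|k IH] u uI; first by [].
  rewrite big_ord_recl; apply: (@order_geM 1 k); first by apply: point_ideal_order.
  exact: IH.
have [_ ap bp _] := F.
rewrite -[f]frame_toK; apply: (@mpoly_msupp_ind _ _ (fun g => ideal_pow _ k (from g))).
- by rewrite /from raddf0; exact: ideal_gen0.
- by move=> g h; rewrite /from raddfD; exact: ideal_genD.
move=> m /fk le_k; rewrite /from linearZ /= -mul_mpolyC; apply: ideal_genMl.
rewrite mpolyXE_id rmorph_prod; apply: ideal_powW le_k _.
rewrite big_ord3 /= mulrA -[(_ + _)%N]addn0.
apply: ideal_powM; last exact: ideal_pow0.
rewrite !rmorphXn /= -/from frame_from0 frame_from1.
by apply: ideal_powM; apply: ideal_pow_exp; exact: linform_point_ideal.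
Qed.

(** Dividing by x_0 lowers the order in (x_0, x_1) by one. *)
Lemma ideal_pow_cancel_vanishing k f :
  ideal_pow (point_ideal p) k (linform a * f) -> ideal_pow (point_ideal p) k.-1 f.
Proof.
rewrite !ideal_pow_pointE /to rmorphM /= -/to frame_to0 => fk m.
rewrite -(mcoeff_mulXU i0) => /fk; rewrite !mnmDE !mnm1E /=; lia.
Qed.

(** Any line missing [p] can serve as third coordinate of a frame, and dividing by x_2 leaves the
    order unchanged. *)
Lemma ideal_pow_cancel_nonvanishing k f :
  ideal_pow (point_ideal p) k (linform d * f) -> ideal_pow (point_ideal p) k f.
Proof.
rewrite !ideal_pow_pointE /to rmorphM /= -/to frame_to2 => fk m.
rewrite -(mcoeff_mulXU i2) => /fk; rewrite !mnmDE !mnm1E /=; lia.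
Qed.

(** Membership in the monomial ideal (x_0, x_1^k). *)
Let monom_in k g := forall m, g@_m != 0 -> (0 < m i0)%N || (k <= m i1)%N.

Lemma monom_inE k f :
  (exists u v, f = linform a * u + linform b ^+ k * v) <-> monom_in k (to f).
Proof.
split=> [[u [v ->]] m|fk].
  rewrite /to rmorphD !rmorphM rmorphXn /= -/to frame_to0 frame_to1.
  rewrite mcoeffD; apply: contraR; rewrite negb_or -eqn0Ngt -ltnNge => /andP[m0 m1].
  apply/eqP; rewrite [X in X + _]memN_msupp_eq0 ?add0r.
    apply: memN_msupp_eq0; apply/negP; move=> /msuppM_le /allpairsP[[x y]] /=.
    rewrite mpolyXn msuppX mem_seq1 => -[/eqP -> _ mE].
    by move: m1; rewrite mE mnmDE mulmnE mnm1E /=; lia.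
  apply/negP; move=> /msuppM_le /allpairsP[[x y]] /=.
  rewrite msuppX mem_seq1 => -[/eqP -> _ mE].
  by move: m0; rewrite mE mnmDE mnm1E.
rewrite -[f]frame_toK -frame_from0 -frame_from1.
apply: (@mpoly_msupp_ind _ _ (fun g => exists u v, from g = from 'X_i0 * u + from 'X_i1 ^+ k * v)).
- by exists 0, 0; rewrite /from raddf0 !mulr0 addr0.
- move=> g h [u [v gE]] [u' [v' hE]]; exists (u + u'), (v + v').
  by rewrite /from raddfD /= -/from gE hE !mulrDr addrACA.
move=> m; set c := _@_m => /fk /orP[/(dvdX_mnm K)[m' ->]|/(dvdX_mnm K)[m' ->]].
  exists (from (c *: 'X_[m'])), 0; rewrite mulr0 addr0 /from -rmorphM /=.
  by rewrite expr1 -scalerAr.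
exists 0, (from (c *: 'X_[m'])); rewrite mulr0 add0r /from -rmorphXn -rmorphM /=.
by rewrite -scalerAr.
Qed.

(** In coordinates, (x_0, x_1)^k is contained in (x_0, x_1^k). *)
Lemma ideal_pow_point_sub k f : ideal_pow (point_ideal p) k f ->
  exists u v, f = linform a * u + linform b ^+ k * v.
Proof.
by move=> /ideal_pow_pointE fk; apply/monom_inE => m /fk; case: (m i0).
Qed.

(** In coordinates, x_2 is a nonzerodivisor modulo (x_0, x_1^k). *)
Lemma primary_cancel k f :
    (exists u v, linform d * f = linform a * u + linform b ^+ k * v) ->
  exists u v, f = linform a * u + linform b ^+ k * v.
Proof.
rewrite !monom_inE /to rmorphM /= -/to frame_to2 => fk m.
by rewrite -(mcoeff_mulXU i2) => /fk; rewrite !mnmDE !mnm1E /= !addn0.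
Qed.

Lemma linform_Gauss f h :
  linform a * h = linform b * f -> exists f', f = linform a * f'.
Proof.
move=> /(congr1 to); rewrite /to !rmorphM /= -/to frame_to0 frame_to1 => E.
have f0 m : (to f)@_m != 0 -> (0 < m i0)%N.
  rewrite -(mcoeff_mulXU i1) -E -mcoeff_msupp => /msuppM_le /allpairsP[[x y]] /=.
  rewrite msuppX mem_seq1 => -[/eqP -> _ /mnmP/(_ i0)].
  by rewrite !mnmDE !mnm1E /= addn0 => ->.
rewrite -[f]frame_toK -frame_from0.
apply: (@mpoly_msupp_ind _ _ (fun g => exists f', from g = from 'X_i0 * f')).
- by exists 0; rewrite /from raddf0 mulr0.
- move=> g g' [u gE] [u' gE']; exists (u + u').
  by rewrite /from raddfD /= -/from gE gE' mulrDr.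
move=> m; set c := _@_m => /f0 /(dvdX_mnm K)[m' ->].
by exists (from (c *: 'X_[m'])); rewrite /from -rmorphM /= expr1 -scalerAr.
Qed.

End Frame.

End LinearForms.

(** * The ideal of a fat grid *)

Section Grid.
Variables (K : fieldType) (r s : nat).
Variables (R : 'I_r -> 'I_3 -> K) (C : 'I_s -> 'I_3 -> K).
Variable p : 'I_r -> 'I_s -> 'I_3 -> K.
Hypothesis indRC : forall i j, indep (R i) (C j).
Hypothesis p_neq0 : forall i j, nonzero (p i j).
Hypothesis R_p : forall k i j, (dot (R k) (p i j) == 0) = (k == i).
Hypothesis C_p : forall l i j, (dot (C l) (p i j) == 0) = (l == j).
Local Notation S := {mpoly K[3]}.
Local Notation Lf i := (linform (R i)).
Local Notation Cf j := (linform (C j)).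

Lemma dot_R i j : dot (R i) (p i j) = 0.
Proof. by apply/eqP; rewrite R_p. Qed.

Lemma dot_C i j : dot (C j) (p i j) = 0.
Proof. by apply/eqP; rewrite C_p. Qed.

Lemma indepC (a b : 'I_3 -> K) : indep a b -> indep b a.
Proof.
by move=> ab x y xy0; have [|-> ->] := ab y x _; first by move=> i; rewrite addrC.
Qed.

(** The third form is a coordinate function that does not vanish at the point. *)
Lemma grid_frame i j : exists d, frame (R i) (C j) d (p i j).
Proof.
have [k pk] := p_neq0 i j; exists (fun l => (l == k)%:R).
split; [exact: indRC|exact: dot_R|exact: dot_C|].
rewrite /dot (bigD1 k) //= big1 ?addr0 ?eqxx ?mul1r // => l /negPf ->.
by rewrite mul0r.
Qed.

Lemma frame_sym (a b d q : 'I_3 -> K) : frame a b d q -> frame b a d q.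
Proof. by move=> [ab aq bq dq]; split=> //; exact: indepC. Qed.

(** A column other than [j] misses the point [p i j], so each of its factors can be cancelled by
    [primary_cancel]. *)
Lemma Cprod_cancel i j k (e : 'I_s -> nat) js h : j \notin js ->
    (exists u v, \prod_(l <- js) Cf l ^+ e l * h = Lf i * u + Cf j ^+ k * v) ->
  exists u v, h = Lf i * u + Cf j ^+ k * v.
Proof.
elim: js h => [|l js IH] h; first by rewrite big_nil mul1r.
rewrite inE negb_or big_cons => /andP[lj js_j] H; apply: IH => //.
move: H; rewrite -mulrA; elim: (e l) => [|n IHn]; first by rewrite expr0 mul1r.
rewrite exprS -mulrA => H; apply: IHn; move: H; apply: (@primary_cancel _ _ _ (C l) (p i j)).
split; [exact: indRC|exact: dot_R|exact: dot_C|by rewrite C_p eq_sym].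
Qed.

(** Columns are added one at a time: if [f] is [v] times the product over the earlier columns modulo
    R_i, then [Cprod_cancel] puts [v] itself in the ideal of R_i and the next column power. *)
Lemma row_restriction i (e : 'I_s -> nat) js f : uniq js ->
    (forall j, j \in js -> exists u v, f = Lf i * u + Cf j ^+ e j * v) ->
  exists u v, f = Lf i * u + \prod_(j <- js) Cf j ^+ e j * v.
Proof.
elim: js => [_ _|j js IH /= /andP[j_js js_uniq] fE].
  by exists 0, f; rewrite mulr0 add0r big_nil mul1r.
have [u [v fE1]] := IH js_uniq (fun l l_js => fE l (@mem_behead _ (j :: js) l l_js)).
have [u1 [v1 fE2]] := fE j (mem_head _ _).
have [] : exists u v', v = Lf i * u + Cf j ^+ e j * v'.
  apply: (Cprod_cancel (e := e) j_js); exists (u1 - u), v1.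
  by rewrite mulrBr addrAC -fE2 fE1 addrAC subrr add0r.
move=> u2 [v2 vE]; exists (u + \prod_(l <- js) Cf l ^+ e l * u2), v2.
rewrite fE1 vE big_cons; ring.
Qed.

Variable delta : 'I_s -> nat.

Definition Cpow T : S := \prod_j Cf j ^+ (T - delta j).

Definition row_count (i : 'I_r) (l : seq ('I_r * nat)) := count (fun x => x.1 == i) l.

(** The conditions that let one pair be peeled: the head has the current height of its row, and no
    row is higher. *)
Fixpoint staircase (l : seq ('I_r * nat)) : Prop :=
  if l is x :: l' then
    [/\ x.2 = (row_count x.1 l').+1, forall i, (row_count i l' <= x.2)%N
      & staircase l']
  else True.

(** At [k = size l] the default level 0 makes the column factor equal to 1. *)
Definition stair_gen (l : seq ('I_r * nat)) k : S :=
  \prod_(x <- take k l) Lf x.1 * Cpow (nth 0%N (unzip2 l) k).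

(** Only the heights [c] vary along the induction: peeling a copy of R_i lowers [c i] by one and
    keeps the deficits of the columns. *)
Definition fat_ideal (c : 'I_r -> nat) f : Prop :=
  forall i j, ideal_pow (point_ideal (p i j)) (c i - delta j) f.

Lemma Cpow_fat c T : (forall i, (c i <= T)%N) -> fat_ideal c (Cpow T).
Proof.
move=> le_cT i j; apply: (@ideal_powW _ _ _ (T - delta j)); first by rewrite leq_sub2r.
rewrite /Cpow (bigD1 j) //= -[(T - _)%N]addn0; apply: ideal_powM; last exact: ideal_pow0.
by rewrite addn0; apply: ideal_pow_exp; apply: linform_point_ideal; exact: dot_C.
Qed.

Lemma fat_idealD c f g : fat_ideal c f -> fat_ideal c g -> fat_ideal c (f + g).
Proof. by move=> fc gc i j; apply: ideal_genD; [exact: fc|exact: gc]. Qed.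

Lemma fat_idealMl c f g : fat_ideal c g -> fat_ideal c (f * g).
Proof. by move=> gc i j; apply: ideal_genMl; exact: gc. Qed.

Lemma fat_ideal_mul_row c i f :
  fat_ideal c f -> fat_ideal (fun k => (i == k) + c k)%N (Lf i * f).
Proof.
move=> fc k j; have [->|ki] := eqVneq i k; last exact/ideal_genMl/fc.
apply: (@ideal_powW _ _ _ (1 + (c k - delta j))); first by rewrite /=; lia.
apply: ideal_powM; last exact: fc.
rewrite -[linform _]expr1; apply: ideal_pow_exp; apply: linform_point_ideal; exact: dot_R.
Qed.

(** At the points of row [i] the division costs one unit of multiplicity; the line R_i misses all
    the other points. *)
Lemma fat_ideal_cancel_row c i f :
  fat_ideal (fun k => (i == k) + c k)%N (Lf i * f) -> fat_ideal c f.
Proof.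
move=> fc k j; have := fc k j; have [->|ki] := eqVneq i k.
  have [d F] := grid_frame k j; move=> /(ideal_pow_cancel_vanishing F).
  by apply: ideal_powW; lia.
apply: (@ideal_pow_cancel_nonvanishing _ (R k) (C j)).
split; [exact: indRC|exact: dot_R|exact: dot_C|by rewrite R_p].
Qed.

Lemma stair_gen_cons x l k : stair_gen (x :: l) k.+1 = Lf x.1 * stair_gen l k.
Proof. by rewrite /stair_gen /= big_cons mulrA. Qed.

Lemma fat_ideal_stair l f : staircase l ->
  fat_ideal (row_count^~ l) f <->
  exists c : nat -> S, f = \sum_(k < (size l).+1) c k * stair_gen l k.
Proof.
elim: l f => [|[i T] l IH] f /=.
  split=> [_|_ k j]; last by rewrite sub0n; exact: ideal_pow0.
  (* With no pair left all multiplicities are zero, and the single generator is [Cpow 0 = 1]. *)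
  exists (fun=> f); rewrite big_ord1 /stair_gen /= big_nil mul1r /Cpow.
  by rewrite big1 ?mulr1 // => j _; rewrite sub0n.
move=> /= [TE le_T l_stair].
have le_T' k : (row_count k ((i, T) :: l) <= T)%N.
  by rewrite /=; case: eqVneq => [<-|_]; [rewrite add1n -TE|exact: le_T].
have g0E : stair_gen ((i, T) :: l) 0 = Cpow T by rewrite /stair_gen big_nil mul1r.
split=> [fc|[c ->]].
  have [|u [v fE]] := @row_restriction i (fun j => T - delta j)%N
      (index_enum _) f (index_enum_uniq _).
    move=> j _; have [d F] := grid_frame i j.
    apply: (ideal_pow_point_sub F); have := fc i j.
    by rewrite eqxx add1n -TE.
  (* No row is higher than [T], so [Cpow T] lies in the ideal; hence so does the remaining multiple
     of R_i, from which R_i is cancelled. *)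
  have : fat_ideal (row_count^~ l) u.
    apply: (@fat_ideal_cancel_row _ i).
    have -> : Lf i * u = f + - v * Cpow T by rewrite fE /Cpow; ring.
    by apply: fat_idealD => //; apply: fat_idealMl; exact: Cpow_fat.
  case/IH=> // c uE; exists (fun k => if k is k'.+1 then c k' else v).
  rewrite big_ord_recl g0E fE addrC [v * _]mulrC; congr (_ + _).
  rewrite uE mulr_sumr; apply: eq_bigr => k _.
  by rewrite stair_gen_cons mulrCA.
rewrite big_ord_recl; apply: fat_idealD.
  by apply: fat_idealMl; rewrite g0E; exact: Cpow_fat.
under eq_bigr do rewrite stair_gen_cons mulrCA.
rewrite -mulr_sumr.
by apply: fat_ideal_mul_row; apply/IH => //; exists (fun k => c k.+1).
Qed.

Lemma indep_linform_neq0 (a b : 'I_3 -> K) : indep a b -> linform a != 0.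
Proof.
move=> ab; apply/eqP => a0; have [i|/eqP] := ab 1 0; last by rewrite oner_eq0.
rewrite mul1r mul0r addr0; have := linform_eval a (fun l => (l == i)%:R).
rewrite a0 meval0 /dot (bigD1 i) //= big1 ?addr0 ?eqxx ?mulr1 // => l /negPf ->.
by rewrite mulr0.
Qed.

Lemma C_Gauss j (rs : seq 'I_r) h f :
    Cf j * h = \prod_(i <- rs) Lf i * f -> exists f', f = Cf j * f'.
Proof.
elim: rs h f => [|i rs IH] h f; first by rewrite big_nil mul1r => <-; exists h.
rewrite big_cons -mulrA => E; have [d F] := grid_frame i j.
have [w Ew] := linform_Gauss (frame_sym F) E.
exact: IH (esym Ew).
Qed.

Lemma Cprod_Gauss (e : 'I_s -> nat) (rs : seq 'I_r) h f :
    \prod_j Cf j ^+ e j * h = \prod_(i <- rs) Lf i * f ->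
  exists f', f = \prod_j Cf j ^+ e j * f'.
Proof.
(* The empty product is settled directly; otherwise a row [i] is at hand to show that the forms of
   the columns are nonzero. *)
case: rs => [|i rs]; first by rewrite big_nil mul1r => <-; exists h.
move: h f; elim/big_ind: _ => [h f _|W V IHW IHV h f|j _].
- by exists f; rewrite mul1r.
- rewrite -mulrA => /[dup] /IHW[f1 ->].
  have [-> _|W_neq0] := eqVneq W 0; first by exists 0; rewrite !mul0r.
  rewrite [RHS]mulrCA => /(mulfI W_neq0) /IHV[f2 ->].
  by exists f2; rewrite mulrA.
elim: (e j) => [|n IH] h f; first by exists f; rewrite mul1r.
have C_neq0 : Cf j != 0 by exact: indep_linform_neq0 (indepC (@indRC i j)).
rewrite exprS -mulrA => /[dup] /C_Gauss[f1 ->].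
rewrite [RHS]mulrCA => /(mulfI C_neq0) /IH[f2 ->].
by exists f2; rewrite mulrA.
Qed.

End Grid.

(** * Resolutions with a bidiagonal matrix *)

Section Bidiagonal.
Variables (D : idomainType) (n : nat) (A C U W : nat -> D).
Hypothesis A_rec : forall t, (t < n)%N -> A t.+1 = U t * A t.
Hypothesis C_rec : forall t, (t < n)%N -> C t = W t * C t.+1.
Hypothesis A_neq0 : forall t, (t <= n)%N -> A t != 0.
Hypothesis C_neq0 : forall t, (t <= n)%N -> C t != 0.
Hypothesis W_Gauss : forall t h f, (t < n)%N ->
  W t * h = A t.+1 * f -> exists f', f = W t * f'.

(** The bidiagonal matrix applied to [w]: column t has entries [U t] in row t and [- W t] in row
    t+1, which encodes the relation U_t g_t = W_t g_(t+1) for g_t = A_t C_t. *)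
Definition syzygy (w : nat -> D) t : D :=
  U t * w t - (if t is t'.+1 then W t' * w t' else 0).

(** The sum telescopes; for [m = n] and [w n = 0] it says that the image consists of syzygies. *)
Lemma sum_syzygy w m : (m <= n)%N ->
  \sum_(t < m.+1) syzygy w t * (A t * C t) = U m * w m * (A m * C m).
Proof.
elim: m => [|m IH] le_mn; first by rewrite big_ord1 /syzygy subr0.
rewrite big_ord_recr IH ?(ltnW le_mn) //= (C_rec le_mn) (A_rec le_mn) /syzygy.
ring.
Qed.

(** The matrix is lower triangular with nonzero diagonal entries [U t]. *)
Lemma syzygy_eq0 w : (forall t, (t <= n)%N -> syzygy w t = 0) ->
  forall t, (t < n)%N -> w t = 0.
Proof.
move=> w0; have U_neq0 t : (t < n)%N -> U t != 0.
  by move=> lt_tn; move: (A_neq0 lt_tn); rewrite A_rec // mulf_eq0 negb_or => /andP[].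
elim=> [|t IH] lt_tn; have /eqP := w0 _ (ltnW lt_tn); rewrite /syzygy.
  by rewrite subr0 mulf_eq0 (negPf (U_neq0 _ lt_tn)) => /eqP.
by rewrite (IH (ltnW lt_tn)) mulr0 subr0 mulf_eq0 (negPf (U_neq0 _ lt_tn)) => /eqP.
Qed.

Lemma dvd_sum_generators (u : nat -> D) m : (m <= n)%N ->
  exists X, \sum_(t < m.+1) u t * (A t * C t) = C m * X.
Proof.
elim: m => [|m IH] le_mn; first by exists (u 0%N * A 0%N); rewrite big_ord1; ring.
have [X E] := IH (ltnW le_mn); exists (W m * X + u m.+1 * A m.+1).
by rewrite big_ord_recr E /= (C_rec le_mn); ring.
Qed.

(** The terms up to m are divisible by C_m = W_m C_(m+1). Cancelling C_(m+1) shows that W_m divides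
    A_(m+1) u_(m+1), hence u_(m+1), and a multiple of the last relation eliminates this
    coefficient. *)
Lemma syzygy_exact (u : nat -> D) m : (m <= n)%N ->
    \sum_(t < m.+1) u t * (A t * C t) = 0 ->
  exists2 w, (forall t, (m <= t)%N -> w t = 0) &
    forall t, (t <= m)%N -> u t = syzygy w t.
Proof.
elim: m u => [|m IH] u le_mn.
  rewrite big_ord1 => /eqP; rewrite !mulf_eq0 (negPf (A_neq0 _)) // (negPf (C_neq0 _)) //.
  rewrite !orbF => /eqP u0; exists (fun=> 0) => // t.
  by rewrite leqn0 /syzygy => /eqP ->; rewrite mulr0 subr0.
rewrite big_ord_recr /=; have [X E] := dvd_sum_generators u (ltnW le_mn).
move=> sum0; have [f' uE] : exists f', u m.+1 = W m * f'.
  apply: (@W_Gauss m (- X)) => //; apply: (mulIf (C_neq0 le_mn)).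
  apply/eqP; rewrite -subr_eq0; apply/eqP; rewrite -[RHS]oppr0 -sum0 E (C_rec le_mn).
  by ring.
(* With u_(m+1) = W_m f', the last relation replaces the term in g_(m+1) by U_m f' times g_m. *)
have [|w w0 wE] := IH (fun t => u t + (t == m)%:R * (U m * f')) (ltnW le_mn).
  under eq_bigr do rewrite mulrDl.
  rewrite big_split /= -[RHS]sum0; congr (_ + _).
  rewrite big_ord_recr big1 /= => [|t _]; last by rewrite ltn_eqF // !mul0r.
  by rewrite eqxx uE (C_rec le_mn) (A_rec le_mn) mul1r; ring.
(* The sign comes from the entry [- W m] of column m. *)
exists (fun t => if t == m then - f' else w t) => [t lt_mt|t].
  by rewrite gtn_eqF // w0 // ltnW.
rewrite leq_eqVlt => /predU1P[->|]; rewrite /syzygy.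
  rewrite gtn_eqF ?ltnSn // w0 ?leqnSn // eqxx uE; ring.
rewrite ltnS leq_eqVlt => /predU1P[->|lt_tm].
  have := wE m (leqnn m); rewrite eqxx mul1r => um.
  rewrite -[u m](addrK (U m * f')) um.
  rewrite /syzygy w0 //; case: m {le_mn E sum0 uE IH w0 wE um} => [|m]; first ring.
  by rewrite ltn_eqF //; ring.
have := wE t (ltnW lt_tm); rewrite ltn_eqF // mul0r addr0 /syzygy => ->.
by case: t lt_tm => [//|t] lt_tm; rewrite ltn_eqF // ltnW.
Qed.

End Bidiagonal.

(** * Degrees in shifted free modules *)

Section Grading.
Variable K : fieldType.
Local Notation S := {mpoly K[3]}.

Lemma in_shift0 a d : in_shift a d (0 : S).
Proof. by rewrite /in_shift; case: ifP => // _; exact: rpred0. Qed.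

Lemma in_shiftB a d (f g : S) :
  in_shift a d f -> in_shift a d g -> in_shift a d (f - g).
Proof.
rewrite /in_shift; case: ifP => _; first exact: rpredB.
by move=> -> ->; rewrite subr0.
Qed.

Lemma in_shiftM a e d (f g : S) :
  g \is e.-homog -> in_shift (a + e) d f -> in_shift a d (g * f).
Proof.
rewrite /in_shift => g_hom; case: ifP => [le_d f_hom|_ ->]; last first.
  by rewrite mulr0; case: ifP => // _; exact: rpred0.
rewrite (leq_trans (leq_addr e a) le_d).
have -> : (d - a = e + (d - (a + e)))%N by lia.
exact: dhomogM.
Qed.

Lemma homog_irrelevant e (f : S) : (0 < e)%N -> f \is e.-homog -> irrelevant_ideal f.
Proof.
move=> e_gt0 f_hom; apply: (@mpoly_msupp_ind _ _ (@irrelevant_ideal K)).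
- exact: ideal_gen0.
- by move=> g h; exact: ideal_genD.
move=> m; rewrite -mcoeff_msupp => m_supp.
have md : mdeg m = e := dhomog_mf f_hom m_supp.
have /existsP[i mi] : [exists i, (0 < m i)%N].
  apply: contraLR e_gt0 => /existsPn m0; rewrite -md mdegE lt0n negbK.
  by rewrite sum_nat_eq0; apply/forallP => i; rewrite -leqn0 leqNgt m0.
have [m' ->] := dvdX_mnm K mi; rewrite expr1 scalerAr mulrC.
by apply: ideal_gen_mem; exists i.
Qed.

End Grading.

(** * The graded minimal resolution given by a bidiagonal matrix *)

Section Resolution.
Variables (K : fieldType) (n : nat).
Local Notation S := {mpoly K[3]}.
Variables (A C U W : nat -> S).
Variables (d0 d1 du dw : nat -> nat).
Hypothesis A_rec : forall t, (t < n)%N -> A t.+1 = U t * A t.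
Hypothesis C_rec : forall t, (t < n)%N -> C t = W t * C t.+1.
Hypothesis A_neq0 : forall t, (t <= n)%N -> A t != 0.
Hypothesis C_neq0 : forall t, (t <= n)%N -> C t != 0.
Hypothesis W_Gauss : forall t h f, (t < n)%N ->
  W t * h = A t.+1 * f -> exists f', f = W t * f'.
Hypothesis AC_homog : forall t, (t <= n)%N -> A t * C t \is (d0 t).-homog.
Hypothesis U_homog : forall t, (t < n)%N -> U t \is (du t).-homog.
Hypothesis W_homog : forall t, (t < n)%N -> W t \is (dw t).-homog.
Hypothesis du_gt0 : forall t, (t < n)%N -> (0 < du t)%N.
Hypothesis dw_gt0 : forall t, (t < n)%N -> (0 < dw t)%N.
Hypothesis d1U : forall t, (t < n)%N -> d1 t = (d0 t + du t)%N.
Hypothesis d1W : forall t, (t < n)%N -> d1 t = (d0 t.+1 + dw t)%N.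

(** The index types are kept abstract, in bijection with initial segments, so that they can be
    finite sets of pairs such as [VX] and [CX]. *)
Variables (J1 J0 : finType).
Variables (x1 : J1 -> 'I_n) (y1 : 'I_n -> J1).
Variables (x0 : J0 -> 'I_n.+1) (y0 : 'I_n.+1 -> J0).
Hypothesis x1K : cancel x1 y1.
Hypothesis y1K : cancel y1 x1.
Hypothesis x0K : cancel x0 y0.
Hypothesis y0K : cancel y0 x0.

(** Extension by zero makes the term [U n * w n] of the last coordinate vanish, as there are only n
    relations for n+1 generators. *)
Definition extend (w : free_module K J1) t : S :=
  oapp (fun i => w (y1 i)) 0 (insub t).

Definition extend0 (u : free_module K J0) t : S := u (y0 (inord t)).

Definition res_phi (w : free_module K J1) : free_module K J0 :=
  [ffun j => syzygy U W (extend w) (x0 j)].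

Definition res_eps (u : free_module K J0) : S^o :=
  \sum_j u j * (A (x0 j) * C (x0 j)).

Lemma extend_ord w (i : 'I_n) : extend w i = w (y1 i).
Proof. by rewrite /extend valK. Qed.

Lemma extend_out w t : (n <= t)%N -> extend w t = 0.
Proof. by move=> le_nt; rewrite /extend insubF // ltnNge le_nt. Qed.

Lemma extend_linear c w w' t : extend (c *: w + w') t = c * extend w t + extend w' t.
Proof.
rewrite /extend; case: insub => [i|] /=; first by rewrite !ffunE.
by rewrite mulr0 addr0.
Qed.

Lemma res_phi_linear : linear res_phi.
Proof.
move=> c w w'; apply/ffunP => j; rewrite !ffunE /syzygy extend_linear.
have scaleE (x : S) : c *: (x : S^o) = c * x by [].
by case: (val (x0 j)) => [|t]; rewrite ?extend_linear scaleE; ring.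
Qed.

Lemma res_eps_linear : linear res_eps.
Proof.
move=> c u u'; rewrite /res_eps scaler_sumr -big_split; apply: eq_bigr => j _.
by rewrite !ffunE /= mulrDl -scalerAl.
Qed.

HB.instance Definition _ := GRing.isLinear.Build S (free_module K J1)
  (free_module K J0) *:%R res_phi res_phi_linear.

HB.instance Definition _ := GRing.isLinear.Build S (free_module K J0)
  S^o *:%R res_eps res_eps_linear.

Lemma res_epsE u : res_eps u = \sum_(t < n.+1) extend0 u t * (A t * C t).
Proof.
rewrite /res_eps (reindex y0) /=; last by exists x0 => j _.
by apply: eq_bigr => t _; rewrite y0K /extend0 inord_val.
Qed.

Lemma bidiagonal_resolution (deg1 : J1 -> nat) (deg0 : J0 -> nat) (I : S -> Prop) :
    (forall j, deg1 j = d1 (x1 j)) -> (forall j, deg0 j = d0 (x0 j)) ->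
    (forall f, I f <->
       exists u : nat -> S, f = \sum_(t < n.+1) u t * (A t * C t)) ->
  graded_minimal_free_resolution deg1 deg0 I
    (res_phi : {linear free_module K J1 -> free_module K J0})
    (res_eps : {linear free_module K J0 -> S^o}).
Proof.
move=> deg1E deg0E IE; split.
- split=> d.
    move=> w w_deg j; rewrite deg0E ffunE.
    have part t e (g : S) a : ((t < n)%N -> g \is e.-homog) ->
        ((t < n)%N -> d1 t = (a + e)%N) -> in_shift a d (g * extend w t).
      move=> g_hom d1E; have [lt_tn|/extend_out->] := ltnP t n; last first.
        by rewrite mulr0; exact: in_shift0.
      apply: in_shiftM (g_hom lt_tn) _; rewrite -d1E //.
      have := w_deg (y1 (Ordinal lt_tn)); rewrite deg1E y1K /=.
      by rewrite -(extend_ord w (Ordinal lt_tn)).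
    apply: in_shiftB; first exact: (part _ _ _ _ (@U_homog _) (@d1U _)).
    case: (val (x0 j)) => [|t]; first exact: in_shift0.
    exact: (part _ _ _ _ (@W_homog _) (@d1W _)).
  move=> u u_deg; rewrite /= /res_eps; apply: rpred_sum => j _.
  have := u_deg j; rewrite deg0E /in_shift; case: ifP => [le_d uj|_ ->]; last first.
    by rewrite mul0r; exact: rpred0.
  rewrite -(subnK le_d); apply: dhomogM => //; apply: AC_homog.
  by rewrite -ltnS.
- move=> w w' eq_w; apply/ffunP => j.
  suff : extend (w - w') (x1 j) = 0.
    by rewrite extend_ord x1K !ffunE => /eqP; rewrite subr_eq0 => /eqP.
  apply: (syzygy_eq0 (A := A) (U := U) (W := W)) (ltn_ord _) => //.
  move=> t le_tn; have lt_tn : (t < n.+1)%N by [].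
  have : res_phi (w - w') (y0 (Ordinal lt_tn)) = 0.
    by rewrite raddfB /= eq_w subrr ffunE.
  by rewrite ffunE y0K.
- move=> u; split=> [|[w ->]].
    rewrite /= res_epsE.
    case/(syzygy_exact A_rec C_rec A_neq0 C_neq0 W_Gauss (leqnn n)) => w w0 wE.
    exists [ffun j => w (x1 j)]; apply/ffunP => j; rewrite ffunE.
    have := wE (x0 j); rewrite /extend0 inord_val x0K -ltnS ltn_ord => -> //.
    have wext t : extend [ffun j => w (x1 j)] t = w t.
      have [lt_tn|le_nt] := ltnP t n; last by rewrite extend_out ?w0.
      by rewrite (extend_ord _ (Ordinal lt_tn)) ffunE y1K.
    by rewrite /syzygy wext; case: (val _) => [//|t]; rewrite wext.
  rewrite /= res_epsE; under eq_bigr => t _ do rewrite /extend0 ffunE y0K inord_val.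
  by rewrite (sum_syzygy A_rec C_rec) // extend_out // mulr0 mul0r.
- move=> f; rewrite IE; split=> [[u ->]|[u ->]].
    exists [ffun j => u (x0 j)]; rewrite /= res_epsE; apply: eq_bigr => t _.
    by rewrite /extend0 ffunE y0K inord_val.
  by exists (extend0 u); rewrite /= res_epsE.
(* Minimality: the entries [U t] and [- W t] with [t < n] are homogeneous of positive degree, and
   beyond them the extended vector is zero. *)
move=> w j; rewrite ffunE /syzygy -mulN1r.
have irr e t (g : S) : (0 < e)%N -> g \is e.-homog -> irrelevant_ideal (extend w t * g).
  by move=> e_gt0 g_hom; apply: ideal_genMl; exact: homog_irrelevant g_hom.
have irrn t (g : S) (de : nat -> nat) : ((t < n)%N -> (0 < de t)%N) ->
    ((t < n)%N -> g \is (de t).-homog) -> irrelevant_ideal (g * extend w t).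
  move=> e_gt0 g_hom; have [lt_tn|/extend_out->] := ltnP t n; last first.
    by rewrite mulr0; exact: ideal_gen0.
  by rewrite mulrC; apply: irr (e_gt0 lt_tn) (g_hom lt_tn).
apply: ideal_genD; first exact: (irrn _ _ _ (@du_gt0 _) (@U_homog _)).
apply: ideal_genMl; case: (val (x0 j)) => [|t]; first exact: ideal_gen0.
exact: (irrn _ _ _ (@dw_gt0 _) (@W_homog _)).
Qed.

End Resolution.

(** * The geometry of the grid *)

Section Geometry.
Variable K : fieldType.
Implicit Types a b p q x : 'I_3 -> K.

(** For [p] off the axes, these are the coefficients of the line obtained as Hadamard product of the
    line [a] with [p]. *)
Definition line_coef a p : 'I_3 -> K := fun i => a i / p i.

Lemma nonzero_off p : off_axes p -> nonzero p.
Proof. by move=> p_off; exists ord0; exact: p_off. Qed.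

Lemma nonzero_eq0 p : nonzero p -> ~ (forall i, p i = 0).
Proof. by move=> [i pi] /(_ i) pi0; rewrite pi0 eqxx in pi. Qed.

Lemma off_axes_hprod p q : off_axes p -> off_axes q -> off_axes (hprod p q).
Proof. by move=> p_off q_off i; rewrite mulf_neq0. Qed.

Lemma line_coef_hprod a p x : off_axes p ->
  dot (line_coef a p) (hprod p x) = \sum_i a i * x i.
Proof.
by move=> p_off; apply: eq_bigr => i _; rewrite /hprod mulrA divfK.
Qed.

Lemma line_coef_hprodP a p x : off_axes p -> nonzero x ->
  dot (line_coef a p) x = 0 -> line_hprod (line a) p x.
Proof.
move=> p_off [k xk] x0; exists (fun i => x i / p i).
  split; first by exists k; rewrite mulf_neq0 ?invr_eq0.
  by rewrite -[RHS]x0 /dot; apply: eq_bigr => i _; rewrite /line_coef mulrAC mulrA.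
by exists 1 => [|i]; rewrite ?oner_eq0 // mul1r /hprod divfK.
Qed.

Lemma nonzero_line_coef a p : off_axes p -> nonzero a -> nonzero (line_coef a p).
Proof. by move=> p_off [k ak]; exists k; rewrite mulf_neq0 ?invr_eq0. Qed.

(* The line a = 0 meets the coordinate line x_k = 0, so it contains a point
   which is not p. *)
Lemma indep_meet a b p : nonzero a -> nonzero b -> off_axes p ->
    (forall q, nonzero q -> dot a q = 0 -> dot b q = 0 -> peq p q) ->
  indep a b.
Proof.
have half a' b' (x y : K) : nonzero a' -> off_axes p ->
    (forall q, nonzero q -> dot a' q = 0 -> dot b' q = 0 -> peq p q) ->
    (forall i, x * a' i + y * b' i = 0) -> y = 0.
  move=> a_neq0 p_off meet xy0; apply/eqP; apply: contraT => y_neq0.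
  (* If [y] is nonzero, [b'] vanishes wherever [a'] does, so every point of the line [a'] is [p],
     which has no zero coordinate. *)
  have offq q : dot a' q = 0 -> (exists k, q k = 0) -> forall k, q k = 0.
    move=> aq [k qk] l; apply/eqP; apply: contraT => ql.
    have [||c c_neq0 qE] := meet q _ aq; first by exists l.
      apply: (mulfI y_neq0); rewrite mulr0; transitivity (\sum_i (x * a' i + y * b' i) * q i).
        under [RHS]eq_bigr do rewrite mulrDl -!mulrA.
        by rewrite big_split /= -!mulr_sumr -/(dot a' q) aq mulr0 add0r.
      by rewrite big1 // => i _; rewrite xy0 mul0r.
    by have := mulf_neq0 c_neq0 (p_off k); rewrite -qE qk eqxx.
  case: (nonzero_eq0 a_neq0) => i.
  (* These vectors solve [a' = 0] on x_2 = 0 and on x_1 = 0 respectively; if both are zero, so is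
     [a']. *)
  pose q1 : 'I_3 -> K := fun l => [:: - a' (inord 1); a' ord0; 0]`_l.
  pose q2 : 'I_3 -> K := fun l => [:: - a' (inord 2); 0; a' ord0]`_l.
  have o1 : inord 1 = @Ordinal 3 1 isT by apply: val_inj; rewrite /= inordK.
  have o2 : inord 2 = @Ordinal 3 2 isT by apply: val_inj; rewrite /= inordK.
  have o0 : ord0 = @Ordinal 3 0 isT by apply: val_inj.
  have q1_0 : forall l, q1 l = 0.
    apply: offq; last by exists (@Ordinal 3 2 isT).
    by rewrite /dot big_ord3 /q1 /= o1 o0; ring.
  have q2_0 : forall l, q2 l = 0.
    apply: offq; last by exists (@Ordinal 3 1 isT).
    by rewrite /dot big_ord3 /q2 /= o2 o0; ring.
  have := q1_0 ord0; have := q1_0 (inord 1); have := q2_0 ord0.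
  rewrite o1 /q1 /q2 /= o1 o2 o0 => /eqP; rewrite oppr_eq0 => /eqP a2 a0 /eqP.
  by rewrite oppr_eq0 => /eqP a1; case: (ord3P i) => ->.
move=> a0 b0 p_off meet x y xy0; split; last exact: half meet xy0.
apply: (half b a y x) => // [q q0 bq aq|i]; first exact: meet.
by rewrite addrC.
Qed.

End Geometry.

(** * Enumerating a finite set of pairs *)

Section Enumeration.

Lemma fset_enum n (F : nat -> nat * nat) (A : {fset nat * nat}) :
    {in gtn n &, injective F} ->
    (forall x, x \in A <-> exists2 t, (t < n)%N & x = F t) ->
  exists (x : A -> 'I_n) (y : 'I_n -> A),
    [/\ cancel x y, cancel y x & forall j, val j = F (x j)].
Proof.
move=> F_inj AE.
have memF (t : 'I_n) : F t \in A by apply/AE; exists t.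
have exF (j : A) : exists t : 'I_n, F t == val j.
  by have /AE[t lt_tn ->] := valP j; exists (Ordinal lt_tn).
pose x (j : A) := xchoose (exF j); pose y (t : 'I_n) : A := [` memF t]%fset.
have xE j : F (x j) = val j by apply/eqP; exact: (xchooseP (exF j)).
exists x, y; split=> [j|t|j]; last by rewrite xE.
  by apply: val_inj; rewrite /= xE.
by apply: val_inj; apply: F_inj; rewrite ?inE ?ltn_ord // xE.
Qed.

End Enumeration.

(** * Linear combinations of finitely many generators *)

Section Lincomb.
Variables (D : comNzRingType) (g : nat -> D) (n : nat).

Definition lincomb f := exists c : nat -> D, f = \sum_(k < n.+1) c k * g k.

Lemma lincombD f h : lincomb f -> lincomb h -> lincomb (f + h).
Proof.
move=> [c ->] [d ->]; exists (fun k => c k + d k).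
by rewrite -big_split; apply: eq_bigr => k _; rewrite mulrDl.
Qed.

Lemma lincombMl a f : lincomb f -> lincomb (a * f).
Proof.
move=> [c ->]; exists (fun k => a * c k).
by rewrite mulr_sumr; apply: eq_bigr => k _; rewrite mulrA.
Qed.

Lemma lincomb_mem k : (k <= n)%N -> lincomb (g k).
Proof.
rewrite -ltnS => lt_kn; exists (fun l => (l == k)%:R).
rewrite (bigD1 (Ordinal lt_kn)) //= eqxx mul1r big1 ?addr0 // => l lk.
by rewrite [_ == _](negPf lk) mul0r.
Qed.

End Lincomb.

Lemma lincomb_sub (D : comNzRingType) (g g' : nat -> D) n n' f :
  (forall k, (k <= n)%N -> lincomb g' n' (g k)) -> lincomb g n f -> lincomb g' n' f.
Proof.
move=> gg' [c ->]; elim/big_ind: _ => [||k _].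
- by exists (fun=> 0); rewrite big1 // => k _; rewrite mul0r.
- exact: lincombD.
by apply: lincombMl; apply: gg'; rewrite -ltnS.
Qed.

(** * The numerical data *)

Section Levels.
Local Open Scope nat_scope.
Variables (r s : nat) (M : r.-tuple nat) (N : s.-tuple nat).
Hypothesis r_gt0 : 0 < r.
Hypothesis s_gt0 : 0 < s.
Hypothesis M_gt0 : all (leq 1) M.
Hypothesis N_gt0 : all (leq 1) N.
Hypothesis N_sorted : sorted leq N.
Local Notation ns := (last 0 N).
Local Notation mX := Defs.mX.

Definition deficit (j : 'I_s) : nat := ns - tnth N j.

Definition row_height (i : 'I_r) := tnth M i + ns - 1.

Definition level_geq (x y : 'I_r * nat) := y.2 <= x.2.

(* The pair (i, T) stands for a_(i,h) with T = m_i + n_s - 1 - h. *)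
Definition levels : seq ('I_r * nat) :=
  sort level_geq [seq (i, T) | i <- enum 'I_r, T <- iota 1 (row_height i)].

(** This is the degree of [Cpow T], and also a_(i,h) for T = m_i + n_s - 1 - h, which therefore
    depends on i and h only through T. *)
Definition alpha T := \sum_j (T - deficit j).

Lemma level_geq_total : total level_geq.
Proof. by move=> x y; exact: leq_total. Qed.

Lemma level_geq_trans : transitive level_geq.
Proof. by move=> y x z yx zy; exact: leq_trans zy yx. Qed.

Lemma mem_levels x : (x \in levels) = (1 <= x.2 <= row_height x.1).
Proof.
rewrite mem_sort; apply/allpairsPdep/idP => [[i [T [_]]]|].
  by rewrite mem_iota add1n ltnS => ? ->.
by case: x => i T /= H; exists i, T; rewrite mem_enum mem_iota add1n ltnS.
Qed.

Lemma uniq_levels : uniq levels.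
Proof.
rewrite sort_uniq; apply: allpairs_uniq_dep; first exact: enum_uniq.
  by move=> i _; exact: iota_uniq.
by move=> [i T] [i' T'] _ _ /= [-> ->].
Qed.

Lemma row_countE (q : seq ('I_r * nat)) i n : uniq q ->
    (forall T, ((i, T) \in q) = (1 <= T <= n)) -> row_count i q = n.
Proof.
move=> q_uniq qE; rewrite /row_count -size_filter -(size_map snd).
have snd_inj : {in [seq x <- q | x.1 == i] &, injective (@snd 'I_r nat)}.
  move=> [j T] [j' T']; rewrite !mem_filter /= => /andP[/eqP -> _] /andP[/eqP -> _].
  by move=> ->.
rewrite -[RHS](size_iota 1); apply: perm_size; apply: uniq_perm.
- by rewrite map_inj_in_uniq // filter_uniq.
- exact: iota_uniq.
move=> T; rewrite mem_iota add1n ltnS -qE; apply/mapP/idP => [[[j T'] ]|qT].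
  by rewrite mem_filter /= => /andP[/eqP -> jq] ->.
by exists (i, T); rewrite ?mem_filter ?eqxx.
Qed.

Lemma row_count_le (q : seq ('I_r * nat)) i n : uniq q ->
    (forall x, x \in q -> 1 <= x.2 <= n) -> row_count i q <= n.
Proof.
move=> q_uniq qn; rewrite /row_count -size_filter -(size_map snd).
have snd_inj : {in [seq x <- q | x.1 == i] &, injective (@snd 'I_r nat)}.
  move=> [j T] [j' T']; rewrite !mem_filter /= => /andP[/eqP -> _] /andP[/eqP -> _].
  by move=> ->.
rewrite -[n](size_iota 1); apply: uniq_leq_size.
  by rewrite map_inj_in_uniq // filter_uniq.
move=> T /mapP[x]; rewrite mem_filter => /andP[_ /qn x_n] ->.
by rewrite mem_iota add1n ltnS.
Qed.

(** Below a head (i, T), downward closure leaves exactly the heights 1, ..., T-1 in row i, while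
    sorting bounds every other row by T. *)
Lemma staircase_sorted (q : seq ('I_r * nat)) :
    uniq q -> sorted level_geq q -> (forall x, x \in q -> 1 <= x.2) ->
    (forall i T T', (i, T) \in q -> 1 <= T' <= T -> (i, T') \in q) ->
  staircase q.
Proof.
elim: q => [//|[i T] q IH] /andP[iT_q q_uniq] q_sorted q_gt0 q_down.
have le_T x : x \in q -> x.2 <= T.
  by move=> xq; move/(order_path_min level_geq_trans)/allP: q_sorted => /(_ x xq).
have T_gt0 : 0 < T by apply: (q_gt0 (i, T)); exact: mem_head.
split=> /=.
- rewrite (@row_countE _ _ T.-1) ?prednK // => T'.
  apply/idP/andP => [iT'|[T'_gt0 lt_T']].
    split; first by apply: (q_gt0 (i, T')); rewrite inE iT' orbT.
    rewrite -ltnS prednK // ltn_neqAle (le_T _ iT') andbT.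
    by apply: contraNneq iT_q => <-.
  have := q_down i T T' (mem_head _ _); rewrite inE T'_gt0 /= => /(_ _)/predU1P[|[]|//].
    by move: lt_T'; rewrite -ltnS prednK // => /ltnW.
  by move=> T'E; move: lt_T'; rewrite T'E -ltnS prednK // ltnn.
- move=> k; apply: row_count_le => // x xq.
  by rewrite le_T // q_gt0 // inE xq orbT.
apply: IH => //; first exact: path_sorted q_sorted.
  by move=> x xq; apply: q_gt0; rewrite inE xq orbT.
move=> k U U' kU /andP[U'_gt0 le_U'].
(* The tail inherits downward closure: if the lower pair were the head, sorting would force
   [U = U'], and the pair is in the tail anyway. *)
have := q_down k U U'; rewrite inE kU orbT U'_gt0 le_U' => /(_ isT isT)/predU1P[|//].
case=> kE UE; have := le_T _ kU; rewrite /= -UE => le_UU'.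
by rewrite (_ : U' = U) //; apply/eqP; rewrite eqn_leq le_U'.
Qed.

Lemma staircase_levels : staircase levels.
Proof.
apply: staircase_sorted; first exact: uniq_levels.
- exact: sort_sorted level_geq_total _.
- by move=> x; rewrite mem_levels => /andP[].
move=> i T T'; rewrite !mem_levels /= => /andP[_ le_T] /andP[-> le_T'].
exact: leq_trans le_T' le_T.
Qed.

Lemma row_count_levels i : row_count i levels = row_height i.
Proof. by apply: row_countE uniq_levels _ => T; rewrite mem_levels. Qed.

Lemma le_last j : tnth N j <= ns.
Proof.
rewrite (tnth_nth 0) -nth_last; apply: (sorted_leq_nth leq_trans leqnn 0 N_sorted).
- by rewrite inE size_tuple.
- by rewrite inE size_tuple prednK.
by rewrite size_tuple -ltnS prednK.
Qed.

Lemma deficit_multiplicity i j :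
  row_height i - deficit j = tnth M i + tnth N j - 1.
Proof. by rewrite /row_height /deficit; have := le_last j; lia. Qed.

Lemma alphaE T : alpha T = \sum_(ne <- N) (T - (ns - ne)).
Proof. by rewrite big_tuple. Qed.

Lemma alpha_homo : {homo alpha : T T' / T < T'}.
Proof.
move=> T T' lt_T; rewrite /alpha.
(* The last column has deficit zero, so its term grows strictly. *)
have lt_s : s.-1 < s by rewrite prednK.
rewrite [X in X < _](bigD1 (Ordinal lt_s)) //= [X in _ < X](bigD1 (Ordinal lt_s)) //=.
have -> : deficit (Ordinal lt_s) = 0.
  by rewrite /deficit (tnth_nth 0) -nth_last size_tuple subnn.
rewrite !subn0 -addSn leq_add //; apply: leq_sum => j _; exact: leq_sub2r (ltnW lt_T).
Qed.

Lemma alpha_mono : {mono alpha : T T' / T <= T'}.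
Proof. exact: leq_mono alpha_homo. Qed.

Lemma alpha_ltn_mono : {mono alpha : T T' / T < T'}.
Proof. exact: leqW_mono alpha_mono. Qed.

Lemma alpha0 : alpha 0 = 0.
Proof. by rewrite /alpha big1 // => j _; rewrite sub0n. Qed.

(** As [alpha] is increasing, both lists are sorted the same way, and it remains to compare them as
    multisets, reversing h into T in each row. *)
Lemma AX_levels : AX M N = [seq alpha x.2 | x <- levels].
Proof.
apply: (@sorted_eq _ geq).
- by move=> y x z /= yx zy; exact: leq_trans zy yx.
- by move=> x y xy; apply: anti_leq; rewrite andbC.
- by apply: sort_sorted => x y; exact: leq_total.
- rewrite sorted_map.
  apply: (@sub_sorted _ level_geq); last exact: sort_sorted level_geq_total _.
  by move=> x y /=; rewrite alpha_mono.
rewrite perm_sort perm_sym.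
apply: perm_trans; first by apply: perm_map; exact: (permEl (perm_sort _ _)).
have -> : [seq aX N mi h | mi <- M, h <- iota 0 (mi + ns - 1)]
    = [seq aX N (tnth M i) h | i <- enum 'I_r, h <- iota 0 (row_height i)].
  by rewrite -{1}(map_tnth_enum M) allpairs_mapl.
rewrite map_allpairs; elim: (enum 'I_r) => [//|i e IH] /=; apply: perm_cat => //.
have rev_iota n : perm_eq (iota 1 n) [seq n - h | h <- iota 0 n].
  apply: uniq_perm; first exact: iota_uniq.
    rewrite map_inj_in_uniq ?iota_uniq // => h h'; rewrite !mem_iota /=; lia.
  move=> T; rewrite mem_iota; apply/idP/mapP => [T_n|[h]]; last by rewrite mem_iota; lia.
  by exists (n - T); rewrite ?mem_iota; lia.
apply: perm_trans; first by apply: perm_map; exact: rev_iota.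
rewrite -map_comp.
apply/permP => P; congr (count P _); apply: eq_map => h /=; rewrite alphaE /aX /row_height.
apply: eq_big_seq => _ /tnthP[j ->]; have := le_last j.
move: (tnth M i) (tnth N j) (last 0 N) => m n l; lia.
Qed.

(** Zero-based: [level k] is T_(k+1). The default 0 makes the level drop at k = m. *)
Definition level k := nth 0 (unzip2 levels) k.

Lemma nth_AX k : nth 0 (AX M N) k = alpha (level k).
Proof.
rewrite AX_levels /level map_comp -/(unzip2 levels).
have [lt_k|le_k] := ltnP k (size (unzip2 levels)); first by rewrite (nth_map 0).
by rewrite !nth_default ?alpha0 // size_map.
Qed.

Lemma size_levels : size levels = mX M N.
Proof. by rewrite -size_AX // AX_levels size_map. Qed.

Lemma level_anti k k' : k <= k' -> level k' <= level k.
Proof.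
move=> le_k; have [lt_k'|le_k'] := ltnP k' (size (unzip2 levels)); last first.
  by rewrite {1}/level nth_default.
apply: (sorted_leq_nth (leT := geq)) => //.
- by move=> y x z /= yx zy; exact: leq_trans zy yx.
- by move=> x /=.
- by rewrite sorted_map; exact: sort_sorted level_geq_total _.
by rewrite inE (leq_ltn_trans le_k).
Qed.

Lemma level_gt0 k : k < mX M N -> 0 < level k.
Proof.
rewrite -size_levels => lt_k.
have i0 : 'I_r := Ordinal r_gt0.
rewrite /level (nth_map (i0, 0)) //; have := mem_nth (i0, 0) lt_k.
by rewrite mem_levels => /andP[].
Qed.

Lemma level_mX : level (mX M N) = 0.
Proof. by rewrite /level nth_default // size_map size_levels. Qed.

Lemma mX_gt0 : 0 < mX M N.
Proof.
rewrite -size_levels lt0n size_eq0; apply/eqP => l0.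
have := mem_levels (Ordinal r_gt0, 1); rewrite l0 in_nil /row_height /= => /esym/negbT.
have j0 := Ordinal s_gt0.
have := allP M_gt0 _ (mem_tnth (Ordinal r_gt0) M).
have := allP N_gt0 _ (mem_tnth j0 N); have := le_last j0.
move: (tnth M _) (tnth N j0) (last 0 N) => m n l; rewrite /=; lia.
Qed.

(* Positions of the minimal generators. *)
Definition breaks : seq nat :=
  [seq k <- iota 0 (mX M N).+1 | (k == 0) || (level k < level k.-1)].

Definition break t := nth 0 breaks t.

(** The index of the last break, which is also the number of relations. *)
Definition nbreaks := (size breaks).-1.

Lemma mem_breaks k :
  (k \in breaks) = (k <= mX M N) && ((k == 0) || (level k < level k.-1)).
Proof. by rewrite mem_filter mem_iota add0n ltnS andbC. Qed.

Lemma breaks_sorted : sorted ltn breaks.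
Proof. by apply: sorted_filter; [exact: ltn_trans|exact: iota_ltn_sorted]. Qed.

Lemma size_breaks : size breaks = nbreaks.+1.
Proof. by rewrite prednK //= /breaks. Qed.

Lemma breakP k : k \in breaks -> exists2 t, t <= nbreaks & k = break t.
Proof.
move=> kb; exists (index k breaks); last by rewrite /break nth_index.
by rewrite -ltnS -size_breaks index_mem.
Qed.

Lemma break_mem t : t <= nbreaks -> break t \in breaks.
Proof. by move=> le_t; rewrite mem_nth // size_breaks. Qed.

Lemma break_ltn t u : t < u <= nbreaks -> break t < break u.
Proof.
move=> /andP[lt_tu le_u].
apply: (sorted_ltn_nth ltn_trans 0 breaks_sorted) => //; rewrite inE size_breaks ltnS //.
exact: leq_trans (ltnW lt_tu) le_u.
Qed.

Lemma break_inj t u : t <= nbreaks -> u <= nbreaks -> break t = break u -> t = u.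
Proof.
move=> le_t le_u; case: (ltngtP t u) => [lt_tu|lt_ut|//] E.
  by have := @break_ltn t u; rewrite lt_tu le_u E ltnn => /(_ isT).
by have := @break_ltn u t; rewrite lt_ut le_t E ltnn => /(_ isT).
Qed.

Lemma break_le t : t <= nbreaks -> break t <= mX M N.
Proof. by move=> /break_mem; rewrite mem_breaks => /andP[]. Qed.

Lemma break0 : break 0 = 0.
Proof. by rewrite /break /breaks /=. Qed.

(** A drop of the level strictly between two consecutive breaks would itself be a break. *)
Lemma level_const t k : t < nbreaks -> break t <= k < break t.+1 ->
  level k = level (break t).
Proof.
move=> lt_t; elim: k => [|k IH] /andP[].
  by rewrite leqn0 => /eqP ->.
rewrite leq_eqVlt => /predU1P[-> //|le_k lt_k].
rewrite -IH; last by rewrite -ltnS le_k ltnW.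
apply/eqP; rewrite eqn_leq level_anti //= leqNgt; apply/negP => drop.
have [|u le_u kE] := @breakP k.+1.
  by rewrite mem_breaks drop orbT andbT (leq_trans (ltnW lt_k)) // break_le.
have := @break_ltn u t; have := @break_ltn t.+1 u; move: le_k lt_k; rewrite kE.
case: (ltngtP u t) => [|lt_tu|->]; [lia| |by rewrite ltnn].
case: (ltngtP u t.+1) => [|_|->]; [lia| |by rewrite ltnn].
lia.
Qed.

Lemma level_before_break t : t < nbreaks -> level (break t.+1).-1 = level (break t).
Proof.
move=> lt_t; apply: level_const => //.
by have := @break_ltn t t.+1; rewrite ltnSn lt_t => /(_ isT); lia.
Qed.

Lemma level_break_ltn t : t < nbreaks -> level (break t.+1) < level (break t).
Proof.
move=> lt_t; rewrite -(level_before_break lt_t); have := break_mem lt_t.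
rewrite mem_breaks => /andP[_ /predU1P[b0|//]].
by have := @break_ltn t t.+1; rewrite ltnSn lt_t b0 => /(_ isT).
Qed.

(** An index i counted from 1 is the break i-1, since [alpha] is strictly increasing and so drops of
    alpha_i are drops of the level. The two extra pairs are the breaks 0 and m, the latter with
    level 0. *)
Lemma mem_CX x : x \in CX M N <->
  exists2 t, t < nbreaks.+1 & x = (break t, alpha (level (break t))).
Proof.
have -> : x \in CX M N <-> exists2 k, k \in breaks & x = (k, alpha (level k)).
  rewrite /CX in_fset /= !inE; split=> [|[k]].
    case/or3P=> [/eqP->|/eqP->|/mapP[i]].
    - exists (mX M N); last by rewrite level_mX alpha0.
      rewrite mem_breaks leqnn level_mX level_gt0 ?orbT //.
      by have := mX_gt0; lia.
    - by exists 0; rewrite ?mem_breaks // /alphaX nth_AX.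
    rewrite mem_filter mem_iota /alphaX !nth_AX alpha_ltn_mono => /andP[drop i_m] ->.
    exists i.-1 => //; rewrite mem_breaks drop orbT andbT; lia.
  rewrite mem_breaks => /andP[le_k]; rewrite /alphaX nth_AX.
  have [-> /= _ ->|k_gt0 /= drop ->] := posnP k; first by rewrite eqxx orbT.
  move: le_k; rewrite leq_eqVlt => /predU1P[->|lt_k].
    by rewrite level_mX alpha0 eqxx.
  apply/or3P; constructor 3; apply/mapP; exists k.+1; last by rewrite /alphaX nth_AX.
  rewrite mem_filter mem_iota /alphaX !nth_AX alpha_ltn_mono /= drop /=; lia.
split=> [[k /breakP[t le_t ->] ->]|[t lt_t ->]]; first by exists t.
by exists (break t) => //; exact: break_mem.
Qed.

(** Each break except 0 gives one relation, paired with the value just before the drop, that is, at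
    the preceding break; (m, alpha_m) comes from the break m. *)
Lemma mem_VX x : x \in VX M N <->
  exists2 t, t < nbreaks & x = (break t.+1, alpha (level (break t))).
Proof.
have -> : x \in VX M N <->
    exists2 k, (k \in breaks) && (0 < k) & x = (k, alpha (level k.-1)).
  rewrite /VX in_fset /= !inE; split=> [|[k]].
    case/predU1P=> [->|/mapP[i]].
      exists (mX M N); last by rewrite /alphaX nth_AX.
      rewrite mem_breaks leqnn level_mX level_gt0 ?orbT ?mX_gt0 //.
      by have := mX_gt0; lia.
    rewrite mem_filter mem_iota /alphaX !nth_AX alpha_ltn_mono => /andP[drop i_m] ->.
    exists i.-1 => //; rewrite mem_breaks drop orbT andbT; lia.
  rewrite mem_breaks => /andP[/andP[le_k drop] k_gt0] ->.
  move: le_k; rewrite leq_eqVlt => /predU1P[->|lt_k].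
    by rewrite /alphaX nth_AX eqxx.
  apply/orP; right; apply/mapP; exists k.+1; last by rewrite /alphaX nth_AX.
  rewrite mem_filter mem_iota /alphaX !nth_AX alpha_ltn_mono /=.
  by move: drop; rewrite (gtn_eqF k_gt0) /= => ->; lia.
split=> [[k /andP[/breakP[[|t] le_t ->] k_gt0] ->]|[t lt_t ->]].
- by rewrite break0 in k_gt0.
- by exists t => //; rewrite level_before_break.
exists (break t.+1); last by rewrite level_before_break.
rewrite break_mem //=; have := @break_ltn t t.+1.
by rewrite ltnSn lt_t => /(_ isT); exact: leq_ltn_trans.
Qed.

End Levels.

(** * The resolution of a Hadamard fat grid *)

Section Assembly.
Variables (K : fieldType) (r s : nat).
Variables (R : 'I_r -> 'I_3 -> K) (C : 'I_s -> 'I_3 -> K).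
Variable p : 'I_r -> 'I_s -> 'I_3 -> K.
Hypothesis indRC : forall i j, indep (R i) (C j).
Hypothesis p_neq0 : forall i j, nonzero (p i j).
Hypothesis R_p : forall k i j, (dot (R k) (p i j) == 0) = (k == i).
Hypothesis C_p : forall l i j, (dot (C l) (p i j) == 0) = (l == j).
Variables (M : r.-tuple nat) (N : s.-tuple nat).
Hypothesis r_gt0 : (0 < r)%N.
Hypothesis s_gt0 : (0 < s)%N.
Hypothesis M_gt0 : all (leq 1) M.
Hypothesis N_gt0 : all (leq 1) N.
Hypothesis N_sorted : sorted leq N.
Local Notation S := {mpoly K[3]}.
Local Notation lev := (level M N).
Local Notation brk := (break M N).
Local Notation nb := (nbreaks M N).
Local Notation gen := (stair_gen R C (deficit N) (levels M N)).

Definition Rprod (q : seq ('I_r * nat)) : S := \prod_(x <- q) linform (R x.1).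

Lemma Rprod_homog q : Rprod q \is (size q).-homog.
Proof.
rewrite /Rprod; elim: q => [|x q IH]; first by rewrite big_nil; exact: dhomog1.
by rewrite big_cons; apply: (dhomogM (linform_homog _) IH).
Qed.

Lemma Cprod_homog (e : 'I_s -> nat) :
  \prod_j linform (C j) ^+ e j \is (\sum_j e j)%N.-homog.
Proof.
elim/big_ind2: _ => [|u i v j|j _]; [exact: dhomog1|exact: dhomogM|].
by have := dhomogMn (e j) (linform_homog (C j)); rewrite mul1n.
Qed.

Lemma Rprod_neq0 q : Rprod q != 0.
Proof.
rewrite /Rprod prodf_seq_neq0; apply/allP => x _ /=.
exact: indep_linform_neq0 (@indRC x.1 (Ordinal s_gt0)).
Qed.

Lemma Cprod_neq0 (e : 'I_s -> nat) : \prod_j linform (C j) ^+ e j != 0.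
Proof.
apply/prodf_neq0 => j _; apply: expf_neq0.
exact: indep_linform_neq0 (indepC (@indRC (Ordinal r_gt0) j)).
Qed.

Lemma fat_points_lincomb f :
  (forall i j, ideal_pow (point_ideal (p i j)) (tnth M i + tnth N j - 1)%N f)
  <-> lincomb gen (Defs.mX M N) f.
Proof.
rewrite -size_levels //.
rewrite /lincomb -(fat_ideal_stair indRC p_neq0 R_p C_p (deficit N) f (staircase_levels M N)).
by split=> fI i j; have := fI i j; rewrite /= row_count_levels deficit_multiplicity.
Qed.

(** When the level repeats, the column factor is unchanged and only a row is multiplied in, so the
    new generator is redundant. *)
Lemma gen_step k : (k < Defs.mX M N)%N -> lev k.+1 = lev k ->
  exists i, gen k.+1 = linform (R i) * gen k.
Proof.
move=> lt_k levE; pose x0 := (Ordinal r_gt0, 0%N).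
exists (nth x0 (levels M N) k).1; rewrite /stair_gen (take_nth x0); last first.
  by rewrite size_levels.
rewrite -cats1 big_cat big_seq1 /= -/(lev k) -/(lev k.+1) levE.
by ring.
Qed.

Lemma gen_breaks f : lincomb gen (Defs.mX M N) f <-> lincomb (gen \o brk) nb f.
Proof.
split; apply: lincomb_sub => t le_t; last by apply: lincomb_mem; exact: break_le.
have mem_brk t' : (t' <= nb)%N -> lincomb (gen \o brk) nb (gen (brk t')).
  exact: (@lincomb_mem _ (gen \o brk) nb t').
elim: t le_t => [|k IH] le_k; first by have := mem_brk 0%N isT; rewrite break0.
have [/breakP[t le_t ->]|] := boolP (k.+1 \in breaks M N); first exact: mem_brk.
rewrite mem_breaks le_k /= -leqNgt => lev_le.
have [|i ->] := @gen_step k le_k; last by apply: lincombMl; apply: IH; exact: ltnW.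
by apply/eqP; rewrite eqn_leq lev_le level_anti.
Qed.

Lemma grid_resolution :
  exists (phi : {linear free_module K (VX M N) -> free_module K (CX M N)})
         (eps : {linear free_module K (CX M N) -> S^o}),
    graded_minimal_free_resolution
      (@total_degree (VX M N)) (@total_degree (CX M N))
      (fun f => forall i j,
         ideal_pow (point_ideal (p i j)) (tnth M i + tnth N j - 1)%N f)
      phi eps.
Proof.
have [||x1 [y1 [x1K y1K x1E]]] := @fset_enum nb
    (fun t => (brk t.+1, alpha N (lev (brk t)))) (VX M N).
- by move=> t u lt_t lt_u [E _]; have [] := break_inj lt_t lt_u E.
- by move=> x; exact: mem_VX.
have [||x0 [y0 [x0K y0K x0E]]] := @fset_enum nb.+1
    (fun t => (brk t, alpha N (lev (brk t)))) (CX M N).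
- by move=> t u lt_t lt_u [E _]; exact: break_inj lt_t lt_u E.
- by move=> x; exact: mem_CX.
(* [A] collects the rows peeled before a break and [Cg] the columns left there; [U] and [W] are the
   quotients between consecutive breaks. *)
pose A t := Rprod (take (brk t) (levels M N)).
pose Cg t := Cpow C (deficit N) (lev (brk t)).
pose U t := Rprod (take (brk t.+1 - brk t) (drop (brk t) (levels M N))).
pose W t := \prod_j linform (C j) ^+
  ((lev (brk t) - deficit N j) - (lev (brk t.+1) - deficit N j)).
have lt_brk t : (t < nb)%N -> (brk t < brk t.+1)%N.
  by move=> lt_t; apply: break_ltn; rewrite ltnSn.
have size_take_brk t k : (t <= nb)%N -> (k <= brk t)%N ->
    size (take k (levels M N)) = k.
  move=> le_t le_k; rewrite size_takel // size_levels //.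
  exact: leq_trans le_k (break_le le_t).
exists (res_phi U W y1 x0 : {linear _ -> _}).
exists (res_eps A Cg x0 : {linear _ -> _}).
pose du t := (brk t.+1 - brk t)%N.
pose dw t := (alpha N (lev (brk t)) - alpha N (lev (brk t.+1)))%N.
(* The degree of relation t takes the rows of the later break and the columns of the earlier one,
   the least common multiple of the two generators. *)
apply: (@bidiagonal_resolution _ _ A Cg U W
  (fun t => brk t + alpha N (lev (brk t)))%N
  (fun t => brk t.+1 + alpha N (lev (brk t)))%N du dw) => //.
- move=> t lt_t; rewrite /A /U /Rprod mulrC -big_cat -takeD subnKC //.
  exact: ltnW (lt_brk _ lt_t).
- move=> t lt_t; rewrite /Cg /W /Cpow -big_split; apply: eq_bigr => j _ /=.
  rewrite -exprD subnK // leq_sub2r // ltnW //; exact: level_break_ltn.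
- by move=> t _; exact: Rprod_neq0.
- by move=> t _; exact: Cprod_neq0.
- move=> t h f lt_t; rewrite /A /Rprod -(big_map fst xpredT (fun i => linform (R i))).
  exact: (Cprod_Gauss indRC p_neq0 R_p C_p).
- move=> t le_t; apply: dhomogM; last exact: Cprod_homog.
  by have := Rprod_homog (take (brk t) (levels M N)); rewrite (size_take_brk t).
- move=> t lt_t; have := Rprod_homog (take (du t) (drop (brk t) (levels M N))).
  rewrite size_takel // size_drop size_levels //; apply: leq_sub2r.
  exact: break_le.
- move=> t lt_t; have := Cprod_homog (fun j =>
    (lev (brk t) - deficit N j) - (lev (brk t.+1) - deficit N j))%N.
  rewrite sumnB // => j _; rewrite leq_sub2r // ltnW //; exact: level_break_ltn.
- by move=> t lt_t; rewrite subn_gt0 lt_brk.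
- by move=> t lt_t; rewrite subn_gt0 alpha_ltn_mono // level_break_ltn.
- by move=> t lt_t; rewrite /du; have := lt_brk _ lt_t; lia.
- move=> t lt_t; have : (alpha N (lev (brk t.+1)) < alpha N (lev (brk t)))%N.
    by rewrite alpha_ltn_mono // level_break_ltn.
  rewrite /dw; lia.
- by move=> j; rewrite /total_degree x1E.
- by move=> j; rewrite /total_degree x0E.
by move=> f; rewrite fat_points_lincomb gen_breaks.
Qed.

End Assembly.

Theorem theorem5p7 (K : closedFieldType) (r s : nat)
    (aP aQ : 'I_3 -> K) (P : 'I_r -> 'I_3 -> K) (Q : 'I_s -> 'I_3 -> K)
    (M : r.-tuple nat) (N : s.-tuple nat)
    (r_gt0 : (0 < r)%N) (le_rs : (r <= s)%N)
    (M_gt0 : all (leq 1) M) (N_gt0 : all (leq 1) N)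
    (M_sorted : sorted leq M) (N_sorted : sorted leq N)
    (aP_neq0 : nonzero aP) (aQ_neq0 : nonzero aQ)
    (P_off : forall i, off_axes (P i)) (Q_off : forall j, off_axes (Q j))
    (P_line : forall i, line aP (P i)) (Q_line : forall j, line aQ (Q j))
    (P_inj : forall i k, peq (P i) (P k) -> i = k)
    (Q_inj : forall j l, peq (Q j) (Q l) -> j = l)
    (PQ_neq : forall (i k : 'I_r) (j l : 'I_s), (i < k)%N -> (j < l)%N ->
       ~ peq (hprod (P i) (Q j)) (hprod (P k) (Q l)))
    (PQ_ci : grid_complete_intersection (line aP) (line aQ) P Q) :
  exists (phi : {linear free_module K (VX M N) -> free_module K (CX M N)})
         (eps : {linear free_module K (CX M N) -> {mpoly K[3]}^o}),
    graded_minimal_free_resolution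
      (@total_degree (VX M N)) (@total_degree (CX M N))
      (HFG_ideal P Q M N) phi eps.
Proof.
have [pt_inj _ _ meet] := PQ_ci.
pose p i j := hprod (P i) (Q j).
pose R i := line_coef aQ (P i); pose C j := line_coef aP (Q j).
have p_off i j : off_axes (p i j) by exact: off_axes_hprod.
have p_neq0 i j : nonzero (p i j) by exact: nonzero_off.
have dotR i j : dot (R i) (p i j) = 0.
  by rewrite line_coef_hprod //; have [] := Q_line j.
have dotC i j : dot (C j) (p i j) = 0.
  have [_ <-] := P_line i; rewrite -(line_coef_hprod aP (P i) (Q_off j)).
  by apply: eq_bigr => k _; rewrite /p /hprod [P i k * _]mulrC.
have in_meet i j q : nonzero q -> dot (R i) q = 0 -> dot (C j) q = 0 -> peq (p i j) q.
  by move=> q0 Rq Cq; apply/meet; split; exact: line_coef_hprodP.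
apply: (@grid_resolution K r s R C p) => //.
- move=> i j; apply: indep_meet (p_off i j) _; try exact: nonzero_line_coef.
  exact: in_meet.
(* If R_k passes through the point (i, j), that point lies on R_k and C_j, so it is the point (k,
   j), and distinctness gives k = i. *)
- move=> k i j; apply/eqP/eqP => [Rk|->//].
  by have [] := pt_inj _ _ _ _ (in_meet k j (p i j) (p_neq0 _ _) Rk (dotC _ _)).
- move=> l i j; apply/eqP/eqP => [Cl|->//].
  by have [] := pt_inj _ _ _ _ (in_meet i l (p i j) (p_neq0 _ _) (dotR _ _) Cl).
exact: leq_trans r_gt0 le_rs.
Qed.
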